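(* \textsc{Stars NWS} can be solved in $m^{4t}\cdot \mathrm{poly}(|I|)$ time, where $|I|$ is the instance size, $m=|E(G)|$, and $t=\ell-n+x$ with $x$ the number of connected components of the hypergraph $(V(G),\mathcal{C})$.
   Context: An instance $I$ of \textsc{Stars NWS} consists of a graph $G$ with $n$ vertices and $m$ edges, a collection $\mathcal{C}$ of subsets of $V(G)$ (communities), an edge-weight function $\omega: E(G)\to \mathbb{R}_+$, an integer $\ell$, and a positive real $b$. The question is whether there is a spanning subgraph $G'=(V(G),E')$ with $E'\subseteq E(G)$, $|E'|\le \ell$ and $\omega(E')\le b$ such that for every $C\in\mathcal{C}$ the induced subgraph $G'[C]$ contains a spanning star (some vertex of $C$ is adjacent in $G'$ to all other vertices of $C$). Two vertices are connected in the hypergraph $(V(G),\mathcal{C})$ if there is a sequence of communities $C_1,\dots,C_p$ with the first vertex in $C_1$, the second in $C_p$, and consecutive communities intersecting; connected components are maximal sets of pairwise connected vertices. The parameter $t$ is the feedback edge number of a solution, equal to $\ell-n+x$. *)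

(* Defs.v *)
From HB Require Import structures.
From mathcomp Require Import all_boot all_order all_algebra.
From mathcomp Require Import reals.

Set Implicit Arguments.
Unset Strict Implicit.
Unset Printing Implicit Defensive.

Import Order.TTheory GRing.Theory Num.Theory.

(* Edges are two-element sets of vertices; [weight] is only meaningful on
   [edges]. *)
Record instance (R : realType) := Instance {
  nvert : nat;
  edges : {set {set 'I_nvert}};
  edges_simple : forall e, e \in edges -> #|e| = 2;
  communities : {set {set 'I_nvert}};
  weight : {set 'I_nvert} -> R;
  weight_ge0 : forall e, e \in edges -> (0 <= weight e)%R;
  edge_budget : int;
  weight_budget : R;
  weight_budget_gt0 : (0 < weight_budget)%R }.

Arguments weight {R} i _.

Definition has_spanning_star (V : finType) (E : {set {set V}}) (C : {set V}) :=
  exists2 c, c \in C & forall v, v \in C -> v != c -> [set c; v] \in E.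

Definition yes_instance (R : realType) (I : instance R) :=
  exists E' : {set {set 'I_(nvert I)}},
    [/\ E' \subset edges I,
        (#|E'|%:Z <= edge_budget I)%R,
        (\sum_(e in E') weight I e <= weight_budget I)%R
      & forall C, C \in communities I -> has_spanning_star E' C].

Section Hypergraph.
Variables (V : finType) (H : {set {set V}}).

(* [connect] of this relation, started in [H], is the existence of a sequence
   of members of [H] in which consecutive members intersect. *)
Definition community_step : rel {set V} :=
  [rel A B | (B \in H) && (A :&: B != set0)].

Definition hconnected (u v : V) :=
  [exists A in H, exists B in H,
    [&& u \in A, v \in B & connect community_step A B]].

(* Connectedness is only required of distinct vertices, so a vertex that lies
   in no member of [H] is a component by itself. *)
Definition pairwise_hconnected (S : {set V}) :=
  (S != set0) &&
  [forall u in S, forall v in S, (u != v) ==> hconnected u v].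

Definition hcomponents : {set {set V}} :=
  [set S | maxset pairwise_hconnected S].

End Hypergraph.

Definition fb_edge_number (R : realType) (I : instance R) : int :=
  (edge_budget I - (nvert I)%:Z + #|hcomponents (communities I)|%:Z)%R.

(* Model of computation: first-order recursive (pure LISP) programs over binary
   trees whose leaves are integers or reals, every evaluation step having unit
   cost. Pairs are immutable, hence shared, so each step is a constant number
   of operations of a random access machine. Integers support only successor,
   predecessor and comparison, so that in T steps they grow by at most T plus
   the constants of the program and unit cost is legitimate for them. Reals are
   handled as on a real RAM, restricted to addition, subtraction and
   comparison. *)

Inductive value (R : Type) :=
| VNil
| VInt of int
| VReal of R
| VPair of value R & value R.

Arguments VNil {R}.
Arguments VInt {R} _.

Inductive expr :=
| EVar of nat                            (* de Bruijn index *)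
| ENil
| EInt of int
| EPair of expr & expr
| EFst of expr
| ESnd of expr
| ESucc of expr
| EPred of expr
| EAdd of expr & expr
| ESub of expr & expr
| EIfPair of expr & expr & expr
| EIfLe of expr & expr & expr & expr
| ELet of expr & expr
| ECall of nat & expr.

(* The [f]-th expression is the body of function [f], of one argument. *)
Definition program := seq expr.

(* [eval P env e v t]: [e] evaluates to [v] in [t] steps. *)
Inductive eval (R : realType) (P : program) :
  seq (value R) -> expr -> value R -> nat -> Prop :=
| eval_var env i : i < size env -> eval P env (EVar i) (nth VNil env i) 1
| eval_nil env : eval P env ENil VNil 1
| eval_int env z : eval P env (EInt z) (VInt z) 1
| eval_pair env e1 e2 v1 v2 t1 t2 :
    eval P env e1 v1 t1 -> eval P env e2 v2 t2 ->
    eval P env (EPair e1 e2) (VPair v1 v2) (t1 + t2).+1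
| eval_fst env e v1 v2 t :
    eval P env e (VPair v1 v2) t -> eval P env (EFst e) v1 t.+1
| eval_snd env e v1 v2 t :
    eval P env e (VPair v1 v2) t -> eval P env (ESnd e) v2 t.+1
| eval_succ env e z t :
    eval P env e (VInt z) t -> eval P env (ESucc e) (VInt (z + 1)%R) t.+1
| eval_pred env e z t :
    eval P env e (VInt z) t -> eval P env (EPred e) (VInt (z - 1)%R) t.+1
| eval_add env e1 e2 (x1 x2 : R) t1 t2 :
    eval P env e1 (VReal x1) t1 -> eval P env e2 (VReal x2) t2 ->
    eval P env (EAdd e1 e2) (VReal (x1 + x2)%R) (t1 + t2).+1
| eval_sub env e1 e2 (x1 x2 : R) t1 t2 :
    eval P env e1 (VReal x1) t1 -> eval P env e2 (VReal x2) t2 ->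
    eval P env (ESub e1 e2) (VReal (x1 - x2)%R) (t1 + t2).+1
| eval_ifpair env e e1 e2 w v t t' :
    eval P env e w t ->
    eval P env (if w is VPair _ _ then e1 else e2) v t' ->
    eval P env (EIfPair e e1 e2) v (t + t').+1
| eval_ifle_int env d1 d2 e1 e2 (z1 z2 : int) v t1 t2 t' :
    eval P env d1 (VInt z1) t1 -> eval P env d2 (VInt z2) t2 ->
    eval P env (if (z1 <= z2)%R then e1 else e2) v t' ->
    eval P env (EIfLe d1 d2 e1 e2) v (t1 + t2 + t').+1
| eval_ifle_real env d1 d2 e1 e2 (x1 x2 : R) v t1 t2 t' :
    eval P env d1 (VReal x1) t1 -> eval P env d2 (VReal x2) t2 ->
    eval P env (if (x1 <= x2)%R then e1 else e2) v t' ->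
    eval P env (EIfLe d1 d2 e1 e2) v (t1 + t2 + t').+1
| eval_let env e1 e2 v1 v2 t1 t2 :
    eval P env e1 v1 t1 -> eval P (v1 :: env) e2 v2 t2 ->
    eval P env (ELet e1 e2) v2 (t1 + t2).+1
| eval_call env f e w v t t' :
    f < size P -> eval P env e w t -> eval P [:: w] (nth ENil P f) v t' ->
    eval P env (ECall f e) v (t + t').+1.

(* Function 0 is the entry point. *)
Definition runs (R : realType) (P : program) (input output : value R) (t : nat) :=
  eval P [:: input] (ECall 0 (EVar 0)) output t.

Lemma eval_det (R : realType) (P : program) (env : seq (value R)) e v t v' t' :
  eval P env e v t -> eval P env e v' t' -> v = v' /\ t = t'.
Proof.
move=> ev; elim: ev v' t'; intros;
  match goal with h : eval _ _ _ _ ?t |- _ /\ _ = ?t =>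
    inversion h; subst; clear h end;
  repeat match goal with
  | ih : (forall v t, eval ?P ?env ?e v t -> _), h : eval ?P ?env ?e _ _ |- _ =>
      let E := fresh in
      destruct (ih _ _ h) as [E ?]; clear h ih;
      try discriminate E; try (injection E as); subst
  end; by [].
Qed.

Fixpoint vlist (R : Type) (s : seq (value R)) : value R :=
  if s is v :: s' then VPair v (vlist s') else VNil.

(* Integers count with their binary length, reals count as one unit. *)
Fixpoint vsize (R : Type) (v : value R) : nat :=
  match v with
  | VNil => 1
  | VInt z => (trunc_log 2 `|z|%N).+2
  | VReal _ => 1
  | VPair v1 v2 => (vsize v1 + vsize v2).+1
  end.

Definition encode_vset (R : realType) (n : nat) (A : {set 'I_n}) : value R :=
  vlist [seq VInt (val i)%:Z | i <- enum A].

Definition encode (R : realType) (I : instance R) : value R :=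
  vlist [:: encode_vset R [set: 'I_(nvert I)];
            vlist [seq VPair (encode_vset R e) (VReal (weight I e))
                     | e <- enum (edges I)];
            vlist [seq encode_vset R C | C <- enum (communities I)];
            VInt (edge_budget I);
            VReal (weight_budget I)].

Definition instance_size (R : realType) (I : instance R) : nat :=
  vsize (encode I).

(* Main.v *)
Require Import Defs.
From HB Require Import structures.
From mathcomp Require Import all_boot all_order all_algebra.
From mathcomp Require Import reals zify ring lra.

(* Let G' be a solution with at most l edges. Its feedback edge number is at most
   t, and a union of t independent cycles of length 3 or 4 contains every edge of
   G' on such a cycle, so these edges form a set of size at most 4t, of which the
   algorithm guesses a superset S inside G', in at most m^(4t) ways up to a
   polynomial factor.

   Given S, two stars of G' with distinct centers whose vertex sets share a set X
   form triangles or 4-cycles on X. Call X covered if S contains all edges from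
   some vertex to X. Two communities sharing an uncovered set of at least three
   vertices therefore have the same center and are merged; if they share an
   uncovered set of two vertices, these are the ends of an edge of G'. Let F
   consist of S and of the latter edges. After the merging, the stars of G' are
   disjoint outside F, and each center of G' minimizes the number of edges of its
   star outside F. So the centers can be chosen independently of each other,
   minimizing first the number and then the weight of the edges outside F. *)

Set Implicit Arguments.
Unset Strict Implicit.
Unset Printing Implicit Defensive.

Import Order.TTheory GRing.Theory Num.Theory.

(** * Short cycles *)

(** The obstacle is that there are two budgets: choosing one center per star against both a number
    and a weight resembles a knapsack problem. It disappears because in a solution the number of
    edges outside F is forced, star by star, to be the smallest possible, so the lexicographic
    choice never trades one budget against the other.

    The factor 4 is the length of the longer short cycles: each cycle added to S brings at most four
    edges, one of which can be deleted from G' without disconnecting anything. At most l - (n - x)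
    edges are deleted in this way, because what is left of G' still connects every component of the
    hypergraph.

    Acceptance is sound for an arbitrary guess, since the edges used are all paid for and every
    community receives a star; the guess has to be right for completeness only. The program does not
    know G', so it takes the number of guesses from the input: the edge budget, cut at m, minus the
    rank n - x of the hypergraph. The rank is computed by merging intersecting communities, with the
    procedure that also merges stars. *)

Lemma pairwise_count2 (T : eqType) (r : rel T) (p : pred T) (s : seq T) :
  pairwise r s -> 1 < count p s ->
  exists x y, [/\ x \in s, y \in s, p x, p y & r x y].
Proof.
elim: s => //= x s IH /andP[rx rs]; case: (boolP (p x)) => px /=.
  rewrite ltnS -has_count => /hasP[y ys py].
  by exists x, y; rewrite !inE eqxx ys orbT; split=> //; exact: (allP rx).
move=> /(IH rs)[y [z [ys zs py pz ryz]]].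
by exists y, z; rewrite !inE ys zs !orbT.
Qed.

Section Graphs.
Variable V : finType.
Implicit Types (E T : {set {set V}}) (S F : seq {set V}) (X U : seq V).
Implicit Types (a b c d u v w : V) (C : {set V}).

Definition adj T : rel V := [rel u v | [set u; v] \in T].

Lemma adjC T : symmetric (adj T).
Proof. by move=> u v; rewrite /adj /= setUC. Qed.

Definition simple_edges E := forall e, e \in E -> #|e| = 2.

Lemma simple_neq E u v : simple_edges E -> [set u; v] \in E -> u != v.
Proof. by move=> sE /sE; rewrite cards2; case: eqP. Qed.

(** Asking for the first edge is enough, as rotating a cycle puts any of its edges first.
    Consecutive vertices differ because edges are simple, so only the diagonals of a 4-cycle have to
    be kept from degenerating. *)
Definition short_cycles_in E S :=
  (forall a b c, [set a; b] \in E -> [set b; c] \in E -> [set c; a] \in E ->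
     [set a; b] \in S) /\
  (forall a b c d, a != c -> b != d -> [set a; b] \in E -> [set b; c] \in E ->
     [set c; d] \in E -> [set d; a] \in E -> [set a; b] \in S).

Lemma set2_eq a b u v : ([set a; b] == [set u; v]) =
  (a == u) && (b == v) || (a == v) && (b == u).
Proof.
apply/eqP/idP => [eq_ab|]; last first.
  by case/orP => /andP[/eqP-> /eqP->] //; rewrite setUC.
have: a \in [set u; v] by rewrite -eq_ab !inE eqxx.
have: b \in [set u; v] by rewrite -eq_ab !inE eqxx orbT.
have: u \in [set a; b] by rewrite eq_ab !inE eqxx.
have: v \in [set a; b] by rewrite eq_ab !inE eqxx orbT.
rewrite !inE ![u == _]eq_sym ![v == _]eq_sym.
by do 4![case: eqP => //= _].
Qed.

(* Grow [S] by one short cycle at a time, putting into [R] an edge of it that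
   was not in [S] before. *)
Lemma short_cycle_cover E : simple_edges E ->
  exists S (R : {set {set V}}),
    [/\ {subset S <= E}, short_cycles_in E S, R \subset E,
        size S <= 4 * #|R| & subrel (adj E) (connect (adj (E :\: R)))].
Proof.
move=> sE.
pose inv (S R : {set {set V}}) := [/\ R \subset S, S \subset E, #|S| <= 4 * #|R|
  & subrel (adj S) (connect (adj (S :\: R)))].
suff: forall k (S R : {set {set V}}), #|E :\: S| <= k -> inv S R ->
    exists S' R' : {set {set V}}, inv S' R' /\ short_cycles_in E (enum S').
  case/(_ _ set0 set0 (leqnn _)).
    by split; rewrite ?sub0set ?cards0 // => u v; rewrite /adj /= inE.
  move=> S [R [[sRS sSE leS conS] scS]].
  exists (enum S), R; split=> //; first by move=> e; rewrite mem_enum; apply/subsetP.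
  - exact: subset_trans sSE.
  - by rewrite -cardE.
  - move=> u v; rewrite {1}/adj /= => Euv; have [Suv|Suv] := boolP ([set u; v] \in S).
      apply: connect_sub (conS _ _ Suv) => x y; rewrite /adj /= inE => /andP[nR xyS].
      by apply: connect1; rewrite /adj /= inE nR (subsetP sSE).
    by apply: connect1; rewrite /adj /= inE Euv andbT; apply: contra Suv; apply/subsetP.
elim=> [|k IH] S R leSk invSR.
  exists S, R; split=> //.
  move: leSk; rewrite leqn0 cards_eq0 setD_eq0 => /subsetP sES.
  by split=> *; rewrite mem_enum sES.
(* [Z] is the rest of the cycle, a path of at most three edges between the ends of the new edge.
   That edge lies outside [S] and [Z], so moving it to [R] breaks no earlier connection, and [Z]
   still joins its ends. *)
have grow (Z : {set {set V}}) a b : Z \subset E -> #|Z| <= 3 ->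
    [set a; b] \in E -> [set a; b] \notin S -> [set a; b] \notin Z ->
    connect (adj Z) a b ->
    exists S' R' : {set {set V}}, inv S' R' /\ short_cycles_in E (enum S').
  case: invSR => sRS sSE leS conS sZE leZ Eab nSab nZab conZ.
  set e := [set a; b] in Eab nSab nZab.
  have nRe : e \notin R by apply: contra nSab; apply/subsetP.
  apply: (IH (S :|: (e |: Z)) (e |: R)).
    rewrite -ltnS; apply: leq_trans leSk; apply: proper_card.
    rewrite properE; apply/andP; split.
      by apply/subsetP => x; rewrite !inE !negb_or => /andP[/andP[-> _] ->].
    apply/subsetPn; exists e; first by rewrite inE nSab.
    by rewrite !inE eqxx orbT.
  have sub0 : subrel (adj S) (connect (adj ((S :|: (e |: Z)) :\: (e |: R)))).
    move=> u v /conS; apply: connect_sub => x y; rewrite /adj /= => xyS; apply: connect1.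
    move: xyS; rewrite /adj /= !inE => /andP[nR xyS]; rewrite xyS negb_or nR !andbT.
    by apply: contra nSab => /eqP<-.
  have subZ : subrel (adj Z) (connect (adj ((S :|: (e |: Z)) :\: (e |: R)))).
    move=> u v Zuv; have [|nSuv] := boolP ([set u; v] \in S); first exact: sub0.
    apply: connect1; move: Zuv; rewrite /adj /= !inE negb_or => Zuv.
    rewrite Zuv !orbT andbT; apply/andP; split.
      by apply: contra nZab => /eqP<-.
    by apply: contra nSuv; apply/subsetP.
  split.
  - by rewrite subUset sub1set !inE eqxx orbT /= (subset_trans sRS) // subsetUl.
  - by rewrite !subUset sSE sub1set Eab sZE.
  - rewrite (leq_trans (leq_card_setU _ _)) // !cardsU1 nRe nZab mulnDr addnC.
    by rewrite leq_add.
  - move=> u v; rewrite {1}/adj /= !inE => /or3P[|/eqP uvE|]; [exact: sub0| |exact: subZ].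
    have conab := connect_sub subZ conZ.
    move/eqP: uvE; rewrite set2_eq => /orP[] /andP[/eqP-> /eqP->] //.
    rewrite (sym_connect_sym (@adjC _)) //.
have [/forallP tri|] := boolP [forall a, forall b, forall c,
    [&& [set a; b] \in E, [set b; c] \in E & [set c; a] \in E]
      ==> ([set a; b] \in S)]; last first.
  rewrite negb_forall => /existsP[a]; rewrite negb_forall => /existsP[b].
  rewrite negb_forall => /existsP[c]; rewrite negb_imply => /andP[/and3P[ab bc ca] nS].
  apply: (grow [set [set b; c]; [set c; a]] a b) => //.
  - by rewrite subUset !sub1set bc ca.
  - by rewrite (leq_trans (leq_card_setU _ _)) // !cards1.
  - have := simple_neq sE ab; have := simple_neq sE bc; have := simple_neq sE ca.
    rewrite !inE !set2_eq.
    by do !case: eqVneq => //= ?; subst.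
  - apply: (@connect_trans _ _ c); apply: connect1; rewrite /adj /= !inE ?eqxx ?orbT //.
      by rewrite [[set a; c]]setUC eqxx orbT.
    by rewrite [[set c; b]]setUC eqxx.
have [/forallP quad|] := boolP [forall a, forall b, forall c, forall d,
    [&& a != c, b != d, [set a; b] \in E, [set b; c] \in E, [set c; d] \in E
      & [set d; a] \in E] ==> ([set a; b] \in S)]; last first.
  rewrite negb_forall => /existsP[a]; rewrite negb_forall => /existsP[b].
  rewrite negb_forall => /existsP[c]; rewrite negb_forall => /existsP[d].
  rewrite negb_imply => /andP[/and5P[nac nbd ab bc /andP[cd da]] nS].
  apply: (grow [set [set b; c]; [set c; d]; [set d; a]] a b) => //.
  - by rewrite !subUset !sub1set bc cd da.
  - rewrite (leq_trans (leq_card_setU _ _)) // cards1 addn1 ltnS.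
    by rewrite (leq_trans (leq_card_setU _ _)) // !cards1.
  - have := simple_neq sE ab; have := simple_neq sE bc.
    have := simple_neq sE cd; have := simple_neq sE da.
    move: nac nbd; rewrite !inE !set2_eq.
    by do !case: eqVneq => //= ?; subst.
  - apply: (@connect_trans _ _ d); first apply: connect1.
      by rewrite /adj /= !inE [[set a; d]]setUC eqxx orbT.
    apply: (@connect_trans _ _ c); apply: connect1; rewrite /adj /= !inE.
      by rewrite [[set d; c]]setUC eqxx orbT.
    by rewrite [[set c; b]]setUC eqxx.
exists S, R; split=> //; split.
  move=> a b c ab bc ca; rewrite mem_enum.
  by move/forallP/(_ b)/forallP/(_ c): (tri a); rewrite ab bc ca.
move=> a b c d ac bd ab bc cd da; rewrite mem_enum.
move/forallP/(_ b)/forallP/(_ c)/forallP/(_ d): (quad a).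
by rewrite ac bd ab bc cd da.
Qed.

(* Contracting the edges one by one, each contraction loses at most one label. *)
Lemma contraction_labels T : simple_edges T -> exists lab : V -> V,
  (forall u v, adj T u v -> lab u = lab v) /\ #|V| <= #|T| + #|lab @: setT|.
Proof.
move=> sT; suff: forall s : seq {set V}, {subset s <= T} -> exists lab : V -> V,
    (forall u v, [set u; v] \in s -> lab u = lab v)
    /\ #|V| <= size s + #|lab @: setT|.
  case/(_ (enum T)) => [e|lab [adj_lab le_lab]]; first by rewrite mem_enum.
  exists lab; split; last by rewrite [#|T|]cardE.
  by move=> u v Tuv; apply: adj_lab; rewrite mem_enum.
elim=> [|e s IH] sub.
  by exists id; split=> //; rewrite imset_id cardsT.
have [|lab [adj_lab le_lab]] := IH.
  by move=> x xs; apply: sub; rewrite inE xs orbT.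
have /eqP/cards2P[a [b [_ def_e]]] := sT _ (sub _ (mem_head e s)).
pose lab' v := if lab v == lab a then lab b else lab v.
exists lab'; split.
  move=> u v; rewrite inE => /predU1P[|/adj_lab eq_uv]; last by rewrite /lab' eq_uv.
  move/eqP; rewrite def_e set2_eq /lab' => /orP[] /andP[/eqP-> /eqP->];
    by rewrite eqxx; case: ifP => // /eqP.
have: lab @: setT \subset lab a |: lab' @: setT.
  apply/subsetP => _ /imsetP[v _ ->]; rewrite !inE.
  have [//|ne] := eqVneq (lab v) (lab a).
  by apply/imsetP; exists v; rewrite ?inE // /lab' (negPf ne).
move/subset_leq_card => le_img; apply: leq_trans le_lab _.
rewrite /= addSn -addnS leq_add2l (leq_trans le_img) //.
by rewrite (leq_trans (leq_card_setU _ _)) // cards1.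
Qed.

(* For the components [L] of the hypergraph, [size (flatten (map behead L))] is the
   number of edges of a spanning forest. *)
Lemma behead_rank (L : seq (seq V)) T : simple_edges T ->
  uniq (flatten L) -> {in L, forall X, {in X &, forall u v, connect (adj T) u v}} ->
  size (flatten (map behead L)) <= #|T|.
Proof.
move=> sT uL conL; have [lab [adj_lab le_lab]] := contraction_labels sT.
have con_lab u v : connect (adj T) u v -> lab u = lab v.
  by case/connectP=> p; elim: p u => [|w p IH] u /= => [_ ->|/andP[/adj_lab-> /IH]].
set B := flatten _.
have uB : uniq B.
  have sub : subseq B (flatten L).
    rewrite /B; elim: (L) => //= -[|x X] K IH //=.
    exact: subseq_trans (cat_subseq (subseq_refl _) IH) (subseq_cons _ _).
  exact: subseq_uniq sub uL.
(* Every vertex of [B] has the label of the head of its list, and heads lie outside [B]; so the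
   vertices outside [B] already carry all labels. *)
have: lab @: setT \subset lab @: [set v | v \notin B].
  apply/subsetP => _ /imsetP[v _ ->]; apply/imsetP.
  have [vB|vB] := boolP (v \in B); last by exists v; rewrite ?inE.
  case/flattenP: vB => _ /mapP[[|x X] XL ->] //= vX; exists x; last first.
    by apply: con_lab; apply: (conL _ XL); rewrite inE ?eqxx ?vX ?orbT.
  rewrite inE; apply/negP => /flattenP[_ /mapP[Y YL ->] xY].
  case/splitPr: XL uL YL xY => L1 L2; rewrite flatten_cat mem_cat inE /=.
  rewrite cat_uniq /= => /and3P[_ nh /andP[nx _]] YL xY.
  have xY' := mem_behead xY.
  case/or3P: YL => [YL1|/eqP eY|YL2].
  - by move: nh; rewrite negb_or => /andP[/negP[]]; apply/flattenP; exists Y.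
  - by move: nx; rewrite mem_cat negb_or; move: xY; rewrite eY /= => ->.
  - move: nx; rewrite mem_cat negb_or => /andP[_ /negP[]].
    by apply/flattenP; exists Y.
move/subset_leq_card => le_img; have := cardC [in B]; rewrite (card_uniqP uB) => eqC.
rewrite -(leq_add2r #|[predC [in B]]|) eqC (leq_trans le_lab) // leq_add2l.
rewrite (leq_trans le_img) // (leq_trans (leq_imset_card _ _)) //.
by apply/eq_leq/eq_card => v; rewrite !inE.
Qed.

(** Map each vertex outside [B] to some component containing it. Two such vertices in one component
    are connected in the hypergraph, hence lie in the same list of [L]; but only the head of a list
    can be outside [B], so the map is injective. *)
Lemma hcomponents_behead (H : {set {set V}}) (L : seq (seq V)) :
  uniq (flatten L) ->
  (forall C, C \in H -> exists2 X, X \in L & {subset C <= X}) ->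
  #|V| <= size (flatten (map behead L)) + #|hcomponents H|.
Proof.
move=> uL cov; set B := flatten _.
have same X Y v : X \in L -> Y \in L -> v \in X -> v \in Y -> X = Y.
  move=> XL YL vX vY; case/splitPr: XL uL YL => L1 L2.
  rewrite flatten_cat /= mem_cat inE cat_uniq => /and3P[_ nh].
  rewrite cat_uniq => /and3P[_ nx _] /or3P[YL1|/eqP//|YL2].
    move/hasPn/(_ v): nh; rewrite mem_cat vX => /(_ isT); case/negP.
    by apply/flattenP; exists Y.
  move/hasPn/(_ v): nx => /= nx; have: v \in flatten L2 by apply/flattenP; exists Y.
  by move/nx; rewrite vX.
have hcon u v : hconnected H u v -> exists X, [/\ X \in L, u \in X & v \in X].
  case/existsP=> A /andP[AH] /existsP[D] /andP[DH] /and3P[uA vD].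
  have [X XL AX] := cov _ AH; move=> con; exists X; rewrite XL AX //; split=> //.
  suff: {subset D <= X} by apply.
  case/connectP: con => p; elim: p A X AH XL AX {uA} => [|K p IH] A X AH XL AX /=.
    by move=> _ ->.
  case/andP=> /andP[KH /set0Pn[w /setIP[wA wK]]] pth eqD.
  have [Y YL KY] := cov _ KH.
  have eqXY : X = Y by apply: same (AX _ wA) (KY _ wK).
  by apply: (IH K) => //; rewrite eqXY.
have comp v : exists K, (K \in hcomponents H) && (v \in K).
  have [|K maxK sub] := @maxset_exists _ (pairwise_hconnected H) [set v].
    rewrite /pairwise_hconnected; apply/andP; split.
      by apply/set0Pn; exists v; rewrite inE.
    apply/forallP=> x; apply/implyP=> /set1P->; apply/forallP=> y; apply/implyP=> /set1P->.
    by rewrite eqxx.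
  by exists K; rewrite inE maxK (subsetP sub) ?inE.
pose h v := xchoose (comp v).
have hP v := andP (xchooseP (comp v)).
have hB : {in [set v | v \notin B] &, injective h}.
  move=> u v; rewrite !inE => nu nv eq_h; apply/eqP/negP => /negP ne.
  have [/=] := hP u; rewrite inE => /maxsetp /andP[_ /forallP pw] uK.
  have [_ vK] := hP v; rewrite -/(h v) -eq_h in vK.
  move/implyP/(_ uK)/forallP/(_ v)/implyP/(_ vK): (pw u); rewrite ne /=.
  case/hcon=> X [XL uX vX].
  have head w : w \notin B -> w \in X -> w = head w X.
    case: X XL {uX vX} => // x X XL nw; rewrite inE => /predU1P[//|wX].
    by case/negP: nw; apply/flattenP; exists X => //; apply/mapP; exists (x :: X).
  move/negP: ne; apply; rewrite (head u nu uX) (head v nv vX).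
  by case: (X) uX => //= *; rewrite eqxx.
have := card_in_imset hB; have: h @: [set v | v \notin B] \subset hcomponents H.
  by apply/subsetP => _ /imsetP[v _ ->]; case: (hP v).
move/subset_leq_card=> le1 eq1; rewrite -(cardC [in B]) leq_add ?card_size //.
by rewrite eq1 in le1; apply: leq_trans le1; apply/eq_leq/eq_card => v; rewrite !inE.
Qed.

End Graphs.

(** * Merging communities *)

Section Items.
Variable V : finType.
Implicit Types (E T : {set {set V}}) (S F : seq {set V}) (X U : seq V).
Implicit Types (a b c d u v w : V) (e C : {set V}).

(* [x.1] lists the admissible centers of a star that has to span [x.2]. *)
Definition item := (seq V * seq V)%type.
Implicit Types (x y : item) (L : seq item).

Definition inter X U := [seq v <- X | v \in U].
Definition union X U := [seq v <- X | v \notin U] ++ U.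
(** A common center must be admissible for both stars. After a merge the admissible centers may form
    a proper part of the vertices to be spanned, which is why an item carries two lists. *)
Definition merge_items x y : item := (inter x.1 y.1, union x.2 y.2).
Definition wf_item x := uniq x.2 && all [in x.2] x.1.

Lemma mem_inter X U v : (v \in inter X U) = (v \in X) && (v \in U).
Proof. by rewrite mem_filter andbC. Qed.

Lemma mem_union X U v : (v \in union X U) = (v \in X) || (v \in U).
Proof. by rewrite mem_cat mem_filter; case: (v \in U); rewrite ?orbT ?orbF. Qed.

Lemma size_inter X U : size (inter X U) <= size X.
Proof. by rewrite size_filter count_size. Qed.

Lemma perm_interC X U : uniq X -> uniq U -> perm_eq (inter X U) (inter U X).
Proof.
move=> uX uU; apply: uniq_perm; rewrite ?filter_uniq // => v.
by rewrite !mem_inter andbC.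
Qed.

Lemma wf_merge x y : wf_item x -> wf_item y -> wf_item (merge_items x y).
Proof.
move=> /andP[ux /allP sx] /andP[uy /allP sy]; apply/andP; split.
  rewrite cat_uniq filter_uniq //= uy andbT; apply/hasPn => v vy.
  by rewrite mem_filter vy.
apply/allP => v; rewrite mem_inter => /andP[vx _] /=; rewrite mem_union.
by apply/orP; left; exact: sx.
Qed.

(** * Sequences of merges *)

Section Merges.
Variable link : pred (seq V).

Definition unlinked x y := ~~ link (inter x.2 y.2).

(** The order of the merges and of the list is left open, so that invariants need to be checked for
    a single merge only. The relation serves twice: with [link_star] for stars and with [link_hyper]
    for the components of the hypergraph. *)
Inductive merges : seq item -> seq item -> Prop :=
| merges_perm L L' : perm_eq L L' -> merges L L'
| merges_step x y L L1 L2 : perm_eq L (x :: y :: L1) -> link (inter x.2 y.2) ->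
    merges (merge_items x y :: L1) L2 -> merges L L2.

Lemma merges_perml L L' K : perm_eq L L' -> merges L' K -> merges L K.
Proof.
move=> pL m; case: m pL => [L1 L2 p12|x y L0 L1 L2 p0 lxy m12] pL.
  by apply: merges_perm; apply: perm_trans p12.
by apply: merges_step lxy m12; apply: perm_trans p0.
Qed.

Lemma merges_trans L1 L2 L3 : merges L1 L2 -> merges L2 L3 -> merges L1 L3.
Proof.
elim=> [L L' /merges_perml|x y L K K' p lxy _ IH /IH m]; first exact.
exact: merges_step p lxy m.
Qed.

Lemma merges_cons x L L' : merges L L' -> merges (x :: L) (x :: L').
Proof.
elim=> [{}L {}L' p|y z {}L K K' p lyz _ m].
  by apply: merges_perm; rewrite perm_cons.
apply: (@merges_step y z _ (x :: K)) => //.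
  apply: (@perm_trans _ (x :: y :: z :: K)); first by rewrite perm_cons.
  by rewrite -(cat1s x) -(cat1s y) -(cat1s z) perm_catCA perm_cons perm_catCA.
apply: merges_perml m; rewrite -(cat1s x) -(cat1s (merge_items _ _)) perm_catCA.
by rewrite perm_refl.
Qed.

Lemma merges_size L L' : merges L L' -> size L' <= size L.
Proof.
elim=> [{}L {}L' /perm_size->//|x y {}L K K' /perm_size-> _ _ le_m].
exact: leq_trans le_m _.
Qed.

Lemma merges_forward (Q : item -> Prop) L L' :
  (forall x y, link (inter x.2 y.2) -> Q x -> Q y -> Q (merge_items x y)) ->
  merges L L' -> (forall x, x \in L -> Q x) -> forall x, x \in L' -> Q x.
Proof.
move=> Qm; elim=> [{}L {}L' p QL x|x y {}L K K' p lxy _ IH QL].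
  by rewrite -(perm_mem p); apply: QL.
have {}QL z : z \in x :: y :: K -> Q z by rewrite -(perm_mem p); apply: QL.
apply: IH => z; rewrite inE => /predU1P[->|zK]; last by apply: QL; rewrite !inE zK !orbT.
by apply: Qm => //; apply: QL; rewrite !inE eqxx ?orbT.
Qed.

(** For soundness: a star found for a merged item is handed back to the communities it came from. *)
Lemma merges_backward (Q : item -> Prop) L L' :
  (forall x y, Q (merge_items x y) -> Q x /\ Q y) ->
  merges L L' -> (forall x, x \in L' -> Q x) -> forall x, x \in L -> Q x.
Proof.
move=> Qm; elim=> [{}L {}L' p QL x|x y {}L K K' p lxy _ IH QL z].
  by rewrite (perm_mem p); apply: QL.
have {IH} QK := IH QL; have [Qx Qy] := Qm _ _ (QK _ (mem_head _ _)).
rewrite (perm_mem p) !inE => /or3P[/eqP->|/eqP->|zK] //.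
by apply: QK; rewrite inE zK orbT.
Qed.

Lemma merges_cover (p : pred V) L L' x : merges L L' -> x \in L -> {subset p <= x.2} ->
  exists2 y, y \in L' & {subset p <= y.2}.
Proof.
move=> m; elim: m x => [{}L {}L' pe x|y z {}L K K' pe lyz _ IH x].
  by rewrite (perm_mem pe); exists x.
rewrite (perm_mem pe) !inE => /or3P[/eqP->|/eqP->|xK] sub.
- by apply: (IH (merge_items y z)) => [|v /sub vy]; rewrite ?mem_head // mem_union vy.
- by apply: (IH (merge_items y z)) => [|v /sub vy]; rewrite ?mem_head // mem_union vy orbT.
- by apply: (IH x) => //; rewrite inE xK orbT.
Qed.

End Merges.

(** The center may lie outside [X]. This matters for [covered], where [X] is a set shared by two
    stars whose centers need not belong to it. *)
Definition star (E : {pred {set V}}) c X :=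
  all (fun w => (w == c) || ([set c; w] \in E)) X.
Definition covered S X := [exists c, star [in S] c X].
Definition sat (E : {pred {set V}}) x := has (fun c => star E c x.2) x.1.
Definition link_star S X := (2 < size X) && ~~ covered S X.
Definition link_hyper X := X != [::].

Lemma starP (E : {pred {set V}}) c X :
  reflect {in X, forall w, w != c -> [set c; w] \in E} (star E c X).
Proof.
apply: (iffP allP) => st w /st; first by case/orP=> [/eqP->|//]; rewrite eqxx.
by case: eqVneq => //= _; apply.
Qed.

Lemma eq_covered S X U : X =i U -> covered S X = covered S U.
Proof. by move=> eqX; apply: eq_existsb => c; apply: eq_all_r. Qed.

Lemma link_star_perm S X U : perm_eq X U -> link_star S X = link_star S U.
Proof.
by move=> p; rewrite /link_star (perm_size p) (eq_covered _ (perm_mem p)).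
Qed.

Lemma link_hyper_perm X U : perm_eq X U -> link_hyper X = link_hyper U.
Proof. by move=> p; rewrite /link_hyper -!size_eq0 (perm_size p). Qed.

Lemma sat_merge (E : {pred {set V}}) x y : sat E (merge_items x y) -> sat E x /\ sat E y.
Proof.
case/hasP=> c; rewrite mem_inter => /andP[cx cy] /starP st.
by split; apply/hasP; exists c => //; apply/starP => w wx; apply: st;
   rewrite mem_union wx ?orbT.
Qed.

(** An uncovered edge inside two unlinked items is all that they share, since the shared set is
    uncovered too and then has at most two vertices. A covered edge outside [S] is left out: in a
    solution it would close a triangle with two edges of [S]. *)
Definition fixed_edges (Es S : seq {set V}) L :=
  [seq e : {set V} <- Es | if covered S (enum e) then e \in S
                 else 1 < count (fun x => all [in x.2] (enum e)) L].

Definition new_edges F c X :=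
  [seq [set c; w] | w <- X & (w != c) && ([set c; w] \notin F)].

(** * Correct guesses: [S] lies in a solution [E] and contains its short cycles *)

Section Completeness.
Variables (E : {set {set V}}) (S : seq {set V}).
Hypotheses (simpleE : simple_edges E) (subSE : {subset S <= E}).
Hypothesis shortE : short_cycles_in E S.

(** If one of the centers lies in [X], the vertices [c], [w], [d] form a triangle; otherwise a
    second vertex [u] of [X] gives the 4-cycle [c], [w], [d], [u]. *)
Lemma two_stars c d X w : uniq X -> 1 < size X -> c != d ->
  star E c X -> star E d X -> w \in X -> w != c -> w != d -> [set c; w] \in S.
Proof.
case: shortE => tri quad uX szX ncd /starP stc /starP std wX nwc nwd.
have cw := stc _ wX nwc; have dw := std _ wX nwd.
have wd : [set w; d] \in E by rewrite setUC.
have [cX|ncX] := boolP (c \in X).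
  by apply: (tri c w d) => //; exact: std.
have [dX|ndX] := boolP (d \in X).
  by apply: (tri c w d) => //; rewrite setUC; apply: stc; rewrite // eq_sym.
have: ~~ all (pred1 w) X.
  apply/negP => /all_pred1P eX; move: uX szX; rewrite eX size_nseq.
  by case: (size X) => [|[|n]] //=; rewrite inE eqxx.
case/allPn=> u uX' /= nuw.
have nuc : u != c by apply: contraNneq ncX => <-.
have nud : u != d by apply: contraNneq ndX => <-.
apply: (quad c w d u) => //; first by rewrite eq_sym.
  exact: std.
by rewrite setUC; apply: stc.
Qed.

(** Distinct centers [c] and [d] would make [c] cover the shared set by edges of [S], contrary to
    the link; hence the centers agree and serve the merged item. *)
Lemma link_star_sat x y : wf_item x -> wf_item y -> link_star S (inter x.2 y.2) ->
  sat E x -> sat E y -> sat E (merge_items x y).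
Proof.
move=> /andP[ux _] _ /andP[sz /existsP ncov] /hasP[c cx stc] /hasP[d dy std].
set X := inter _ _ in sz ncov.
have uX : uniq X by rewrite filter_uniq.
have stcX : star E c X.
  by apply/allP => w; rewrite mem_inter => /andP[wx _]; apply: (allP stc).
have stdX : star E d X.
  by apply/allP => w; rewrite mem_inter => /andP[_ wy]; apply: (allP std).
have [eqcd|ncd] := eqVneq c d.
  apply/hasP; exists c; first by rewrite mem_inter cx eqcd dy.
  apply/allP => w; rewrite mem_union => /orP[]; first exact: (allP stc).
  by rewrite eqcd; apply: (allP std).
case: ncov; exists c; apply/starP => w wX nwc.
have [wd|nwd] := eqVneq w d; last first.
  by apply: (two_stars uX _ ncd stcX stdX) => //; apply: ltn_trans sz.
rewrite {w}wd in wX nwc *.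
(* The remaining case is the edge from [c] to [d] itself. A third shared vertex [u] puts it on a
   triangle; this is what the threshold in [link_star] is for. *)
have: ~~ all (fun u => (u == c) || (u == d)) X.
  apply/negP => /allP sub; move: sz; rewrite ltnNge => /negP[].
  apply: (@uniq_leq_size _ X [:: c; d]) => // u /sub; by rewrite !inE.
case/allPn=> u uX' /=; rewrite negb_or => /andP[nuc nud].
case: shortE => tri _; apply: (tri c d u).
- exact: (starP _ _ _ stcX).
- exact: (starP _ _ _ stdX).
- by rewrite setUC; apply: (starP _ _ _ stcX).
Qed.

(** Let [c0] cover the ends of [e]. Either [c0] is one of them and [e] is the covering edge, or [e]
    closes a triangle with the two covering edges, which lie in [E]. *)
Lemma covered_edge e : e \in E -> covered S (enum e) -> e \in S.
Proof.
move=> Ee /existsP[c0 /starP st]; have /eqP/cards2P[a [b [nab eab]]] := simpleE Ee.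
have mem_st w : w \in e -> w != c0 -> [set c0; w] \in S.
  by move=> we; apply: st; rewrite mem_enum.
rewrite eab in Ee mem_st *.
have [ca|nca] := eqVneq a c0.
  by rewrite ca; apply: mem_st; rewrite ?inE ?eqxx ?orbT // -ca eq_sym.
have [cb|ncb] := eqVneq b c0.
  by rewrite setUC cb; apply: mem_st; rewrite ?inE ?eqxx.
case: shortE => tri _; apply: (tri a b c0) => //; apply: subSE.
  by rewrite setUC; apply: mem_st; rewrite // !inE eqxx orbT.
by apply: mem_st; rewrite // !inE eqxx.
Qed.

Lemma sub_covered e : e \in S -> covered S (enum e).
Proof.
move=> eS; have /eqP/cards2P[a [b [nab eab]]] := simpleE (subSE eS).
apply/existsP; exists a; apply/starP => w; rewrite mem_enum eab !inE.
by case/orP=> /eqP-> => [|_]; [rewrite eqxx|rewrite -eab].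
Qed.

Variables (L : seq item) (Es : seq {set V}).
Hypotheses (wfL : forall x, x \in L -> wf_item x) (satL : forall x, x \in L -> sat E x).
Hypothesis unlinkedL : pairwise (unlinked (link_star S)) L.
Hypotheses (simpleEs : {in Es, forall e, #|e| = 2}) (subEs : {subset E <= Es}).
Notation F := (fixed_edges Es S L).

(** For an uncovered edge [e] in two items, unlinkedness forces the shared set [X] to be [e]. If a
    center of one of the two stars lies in [e], then [e] is an edge of that star; otherwise
    [two_stars] makes one center cover [e], a contradiction. *)
Lemma fixed_sub : {subset F <= E}.
Proof.
move=> e; rewrite mem_filter => /andP[Fe Ese].
case: ifP Fe => [_ /subSE//|/negbT ncov /(pairwise_count2 unlinkedL)].
case=> x [y [xL yL /allP ex /allP ey]].
have {}ex v : v \in e -> v \in x.2 by move=> ve; apply: ex; rewrite mem_enum.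
have {}ey v : v \in e -> v \in y.2 by move=> ve; apply: ey; rewrite mem_enum.
set X := inter x.2 y.2; rewrite /unlinked -/X negb_and -leqNgt negbK => szX.
have eX : {subset enum e <= X}.
  by move=> v; rewrite mem_enum mem_inter => ve; rewrite ex ?ey.
have /andP[ux sx] := wfL xL; have /andP[_ sy] := wfL yL.
have ncovX : ~~ covered S X.
  apply: contra ncov => /existsP[c /allP st]; apply/existsP; exists c.
  by apply/allP => w /eX; apply: st.
rewrite (negPf ncovX) orbF in szX.
have uX : uniq X by rewrite filter_uniq.
have sze : size (enum e) = 2 by rewrite -cardE simpleEs.
have [] := uniq_min_size (enum_uniq e) eX; first by rewrite sze.
rewrite sze => szX2 eqX.
have /hasP[c cx stc] := satL xL; have /hasP[d dy std] := satL yL.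
have stcX : star E c X.
  by apply/allP => w; rewrite mem_inter => /andP[wx _]; apply: (allP stc).
have stdX : star E d X.
  by apply/allP => w; rewrite mem_inter => /andP[_ wy]; apply: (allP std).
have /eqP/cards2P[a [b [nab eab]]] := simpleEs Ese.
have in_e z : star E z X -> z \in e -> e \in E.
  move=> /starP st; rewrite {1}eab !inE => /orP[] /eqP ez.
    by rewrite eab -ez; apply: st; rewrite -?eqX ?mem_enum ?eab ?inE ?eqxx ?orbT // ez eq_sym.
  by rewrite eab setUC -ez; apply: st; rewrite -?eqX ?mem_enum ?eab ?inE ?eqxx ?ez.
have [|nc] := boolP (c \in e); first exact: in_e.
have [|nd] := boolP (d \in e); first exact: in_e.
(* A common center would belong to both vertex lists, hence to [X], which is [e]. *)
have ncd : c != d.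
  apply: contraNneq nc => eqcd; rewrite -mem_enum eqX mem_inter (allP sx _ cx) /=.
  by rewrite eqcd (allP sy _ dy).
case/negP: ncov; apply/existsP; exists c; apply/starP => w we nwc.
apply: (two_stars uX _ ncd stcX stdX) => //; rewrite -?szX2 -?eqX //.
by apply: contraNneq nd => <-; rewrite -mem_enum.
Qed.

Lemma sub_fixed : {subset S <= F}.
Proof. by move=> e eS; rewrite mem_filter sub_covered // eS subEs ?subSE. Qed.

Lemma fixed_neighbour c x u v : x \in L -> star E c x.2 -> u \in x.2 -> v \in x.2 ->
  [set u; v] \in F -> u != c -> [set c; u] \in F.
Proof.
move=> xL /starP st ux vx Fuv nuc.
have [<-|nvc] := eqVneq v c; first by rewrite setUC.
apply: sub_fixed; case: shortE => tri _; apply: (tri c u v).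
- exact: st.
- exact: fixed_sub.
- by rewrite setUC; apply: st.
Qed.

(** Turns minimizing the new edges into maximizing the neighbours of the center in [K]; the
    successor accounts for the center. *)
Lemma size_new_edges (K : seq {set V}) c X : uniq X -> c \in X ->
  (size (new_edges K c X) + count (fun w => (w != c) && ([set c; w] \in K)) X).+1
    = size X.
Proof.
move=> uX cX; have: count_mem c X = 1 by rewrite count_uniq_mem ?cX.
suff <- : count_mem c X + (size (new_edges K c X)
    + count (fun w => (w != c) && ([set c; w] \in K)) X) = size X by move->.
rewrite size_map size_filter; elim: X {uX cX} => //= w X <-.
by case: (w == c); case: (_ \in K) => /=; lia.
Qed.

(* An edge of [F] inside [x.2] avoiding [c] forms a triangle with [c], which lies in
   [S]; so [c] is adjacent in [F] to all vertices that are not isolated there. *)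
Lemma new_edges_min c d x : x \in L -> c \in x.1 -> star E c x.2 -> d \in x.1 ->
  size (new_edges F c x.2) <= size (new_edges F d x.2).
Proof.
move=> xL cx st dx; have /andP[ux /allP sx] := wfL xL.
have {}cx : c \in x.2 := sx _ cx; have {}dx : d \in x.2 := sx _ dx.
have := size_new_edges F ux cx; rewrite -(size_new_edges F ux dx) => -[eq_sz].
rewrite -(leq_add2r (count (fun w => (w != c) && ([set c; w] \in F)) x.2)).
rewrite eq_sz leq_add2l -!size_filter.
have [->//|ncd] := eqVneq d c.
pose s := [seq w <- x.2 | (w != d) && ([set d; w] \in F)]; rewrite -/s.
(* Neighbours of [d] in [F] other than [c] are also neighbours of [c]; [c] itself is exchanged for
   [d], along the same edge. This gives an injection. *)
pose swap w := if w == c then d else w.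
rewrite -(size_map swap); apply: uniq_leq_size.
  rewrite map_inj_in_uniq ?filter_uniq // => u v; rewrite !mem_filter /swap.
  move=> /andP[/andP[nud _] _] /andP[/andP[nvd _] _].
  case: eqVneq => [->|_]; case: eqVneq => [->|_] // eq_d.
    by rewrite -eq_d eqxx in nvd.
  by rewrite eq_d eqxx in nud.
move=> _ /mapP[w + ->]; rewrite mem_filter => /andP[/andP[nwd Fdw] wx].
rewrite mem_filter /swap; have [eq_w|nwc] := eqVneq w c.
  by rewrite ncd dx /= andbT setUC -eq_w.
rewrite nwc wx /= andbT; apply: (fixed_neighbour xL st wx dx) => //.
by rewrite setUC.
Qed.

Lemma new_edges_uniq (K : seq {set V}) c X : uniq X -> uniq (new_edges K c X).
Proof.
move=> uX; rewrite map_inj_in_uniq ?filter_uniq // => u v.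
rewrite !mem_filter => /andP[/andP[nuc _] _] /andP[/andP[nvc _] _] /eqP.
rewrite set2_eq => /orP[/andP[_ /eqP//]|/andP[/eqP cv _]].
by rewrite cv eqxx in nvc.
Qed.

Lemma new_edges_mem (K : seq {set V}) c x e : wf_item x -> c \in x.1 ->
  e \in new_edges K c x.2 -> e \notin K /\ all [in x.2] (enum e).
Proof.
move=> /andP[_ /allP sx] cx /mapP[w]; rewrite mem_filter => /andP[/andP[_ nK] wx] ->.
split=> //; apply/allP => v; rewrite mem_enum !inE => /orP[] /eqP-> //.
exact: sx.
Qed.

Lemma new_edges_sub (K : seq {set V}) c X : star E c X -> {subset new_edges K c X <= E}.
Proof.
move=> /starP st _ /mapP[w + ->]; rewrite mem_filter => /andP[/andP[nwc _] wX].
exact: st.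
Qed.

(** An edge of [E] inside two items belongs to [F]: by definition if it is uncovered, and by
    [covered_edge] otherwise. So it is new for neither star. *)
Lemma new_edges_disjoint (cen : item -> V) :
  (forall x, x \in L -> (cen x \in x.1) && star E (cen x) x.2) ->
  uniq (flatten [seq new_edges F (cen x) x.2 | x <- L]).
Proof.
move=> cenP.
(* The list may repeat an item, so the induction keeps track of multiplicities and not only of
   membership. *)
suff: forall L0, {subset L0 <= L} -> (forall p, count p L0 <= count p L) ->
    uniq (flatten [seq new_edges F (cen x) x.2 | x <- L0]) by apply.
elim=> //= x L0 IH subL leL; rewrite cat_uniq.
have xL : x \in L by apply: subL; rewrite mem_head.
have /andP[cx stx] := cenP _ xL.
rewrite IH; last 2 first.
- by move=> y yL; apply: subL; rewrite inE yL orbT.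
- by move=> p; apply: leq_trans (leL p); rewrite leq_addl.
rewrite new_edges_uniq ?andbT /=; last by case/andP: (wfL xL).
apply/hasPn => e /flattenP[_ /mapP[y yL0 ->] ey]; apply/negP => ex.
have yL : y \in L by apply: subL; rewrite inE yL0 orbT.
have /andP[cy _] := cenP _ yL.
have [/negP nF sx] := new_edges_mem (wfL xL) cx ex.
have [_ sy] := new_edges_mem (wfL yL) cy ey.
have Ee := new_edges_sub stx ex; case: nF; rewrite mem_filter subEs // andbT.
case: ifP => [|_]; first exact: covered_edge.
apply: leq_trans (leL _) => /=; rewrite sx ltnS -has_count.
by apply/hasP; exists y.
Qed.

End Completeness.
End Items.

(** * Choosing the centers *)

Section Greedy.
Variables (R : realType) (V : finType) (Es : seq {set V}) (wt : {set V} -> R).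
Hypothesis wt_ge0 : {in Es, forall e, (0 <= wt e)%R}.
Implicit Types (F : seq {set V}) (c : V) (X A : seq V) (L : seq (item V)).
Implicit Types (s : int * R) (o : option (int * R)).

(* A state is the number of edges and the weight that can still be spent. *)
Definition spend s F : int * R := (s.1 - (size F)%:Z, s.2 - \sum_(e <- F) wt e)%R.

Definition cost F c X s : option (int * R) :=
  if star [in Es] c X then Some (spend s (new_edges F c X)) else None.

Definition better o o' : option (int * R) :=
  match o, o' with
  | Some s, Some s' =>
      if (s.1 <= s'.1)%R then
        if (s'.1 <= s.1)%R then if (s.2 <= s'.2)%R then o' else o else o'
      else o
  | Some _, None => o
  | None, _ => o'
  end.

Definition best F A X s : option (int * R) :=
  foldr (fun c => better (cost F c X s)) None A.

Fixpoint choose_centers F L o : option (int * R) :=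
  if o is Some s then
    if L is x :: L' then choose_centers F L' (best F x.1 x.2 s) else o
  else None.

(** The second comparison means that [s.2] is nonnegative; it has the form in which the program can
    evaluate it. *)
Definition accept (l : int) (b : R) F L : bool :=
  if choose_centers F L (Some (spend (l, b) F)) is Some s
  then (0 <= s.1)%R && (b - s.2 <= b)%R else false.

Definition lex_le s s' := (s.1 < s'.1)%R || (s.1 == s'.1) && (s.2 <= s'.2)%R.

Lemma better_lex o s : exists2 s', better o (Some s) = Some s' & lex_le s s'.
Proof.
case: o => [t|] /=; last by exists s; rewrite // /lex_le eqxx lexx orbT.
case: (leP t.1 s.1) => h1; last by exists t; rewrite // /lex_le h1.
case: (leP s.1 t.1) => h2; last by exists s; rewrite // /lex_le eqxx lexx orbT.
have eq1 : t.1 = s.1 by apply/le_anti/andP.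
case: (leP t.2 s.2) => h3; first by exists s; rewrite // /lex_le eqxx lexx orbT.
by exists t; rewrite // /lex_le eq1 eqxx (ltW h3) orbT.
Qed.

Lemma betterC_lex o s : exists2 s', better (Some s) o = Some s' & lex_le s s'.
Proof.
case: o => [t|] /=; last by exists s; rewrite // /lex_le eqxx lexx orbT.
case: (leP s.1 t.1) => h1; last by exists s; rewrite // /lex_le eqxx lexx orbT.
case: (leP t.1 s.1) => h2; last by exists t; rewrite // /lex_le h2.
have eq1 : s.1 = t.1 by apply/le_anti/andP.
case: (leP s.2 t.2) => h3; last by exists s; rewrite // /lex_le eqxx lexx orbT.
by exists t; rewrite // /lex_le eq1 eqxx h3 orbT.
Qed.

Lemma better_or o o' : better o o' = o \/ better o o' = o'.
Proof.
by case: o o' => [s|] [s'|] /=; do ?case: ifP => _; auto.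
Qed.

Lemma lex_trans s1 s2 s3 : lex_le s1 s2 -> lex_le s2 s3 -> lex_le s1 s3.
Proof.
rewrite /lex_le => /orP[h1|/andP[/eqP-> h1]] /orP[h2|/andP[/eqP<- h2]].
- by rewrite (lt_trans h1 h2).
- by rewrite h1.
- by rewrite h2.
- by rewrite eqxx (le_trans h1 h2) orbT.
Qed.

Lemma best_max F A X s c : c \in A -> star [in Es] c X ->
  exists2 s', best F A X s = Some s' & lex_le (spend s (new_edges F c X)) s'.
Proof.
move=> + st; elim: A => //= a A IH; rewrite inE => /predU1P[<-|/IH[s' -> le_s']].
  by rewrite {1}/cost st; apply: betterC_lex.
have [s'' -> le_s''] := better_lex (cost F a X s) s'.
by exists s'' => //; apply: lex_trans le_s''.
Qed.

Lemma best_center F A X s s' : best F A X s = Some s' ->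
  exists c, [/\ c \in A, star [in Es] c X & s' = spend s (new_edges F c X)].
Proof.
elim: A => //= a A IH.
have [->|->] := better_or (cost F a X s) (best F A X s).
  by rewrite /cost; case: ifP => // st [<-]; exists a; rewrite mem_head.
by case/IH=> c [cA st ->]; exists c; rewrite inE cA orbT.
Qed.

Lemma spend_cat s F F' : spend (spend s F) F' = spend s (F ++ F').
Proof. by rewrite /spend size_cat big_cat /=; congr pair; [lia | ring]. Qed.

Lemma choose_centers_sound F L s s' :
  choose_centers F L (Some s) = Some s' ->
  exists Z, [/\ {subset Z <= Es}, s' = spend s Z
    & forall x, x \in L -> sat [in F ++ Z] x].
Proof.
elim: L s => [|x L IH] s /=.
  by case=> <-; exists [::]; split=> //; rewrite /spend big_nil !subr0; case: s.
case best_x: best => [s1|]; last by case: (L).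
have [c [cA /starP st ->]] := best_center best_x.
case/IH=> Z [subZ -> satZ]; exists (new_edges F c x.2 ++ Z); split.
- move=> e; rewrite mem_cat => /orP[/mapP[w + ->]|/subZ//].
  by rewrite mem_filter => /andP[/andP[nwc _] wx]; apply: st.
- by rewrite spend_cat.
- move=> y; rewrite inE => /predU1P[->|/satZ/hasP[d dy std]].
    apply/hasP; exists c => //; apply/starP => w wx nwc.
    suff: [set c; w] \in F ++ new_edges F c x.2 ++ Z by [].
    rewrite !mem_cat; case: (boolP (_ \in F)) => //= nF.
    by apply/orP; left; apply/mapP; exists w; rewrite // mem_filter nwc nF.
  apply/hasP; exists d => //; apply/starP => w wy nwd.
  suff: [set d; w] \in F ++ new_edges F c x.2 ++ Z by [].
  have: [set d; w] \in F ++ Z := starP _ _ _ std w wy nwd.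
  by rewrite !mem_cat; case/orP=> ->; rewrite ?orbT.
Qed.

Lemma sum_list_set (Z : seq {set V}) : {subset Z <= Es} ->
  (\sum_(e in [set e in Z]) wt e <= \sum_(e <- Z) wt e)%R.
Proof.
elim: Z => [|z Z IH] sub; first by rewrite big_nil big_pred0 // => e; rewrite inE.
have {IH} le_Z := IH (fun e eZ => sub e (mem_behead (s := z :: Z) eZ)).
have z0 : (0 <= wt z)%R by apply/wt_ge0/sub/mem_head.
have -> : [set e in z :: Z] = z |: [set e in Z] by apply/setP => e; rewrite !inE.
rewrite big_cons; case: (boolP (z \in Z)) => zZ.
  have -> : z |: [set e in Z] = [set e in Z] by apply/setUidPr; rewrite sub1set inE.
  by rewrite (le_trans le_Z) // lerDr.
by rewrite big_setU1 ?inE //= lerD2l.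
Qed.

Lemma sum_uniq_sub (Z : seq {set V}) (E : {set {set V}}) : uniq Z ->
  {subset Z <= E} -> {subset E <= Es} ->
  (\sum_(e <- Z) wt e <= \sum_(e in E) wt e)%R.
Proof.
move=> uZ ZE EEs; rewrite big_uniq //= big_mkcond [leRHS]big_mkcond.
apply: ler_sum => e _; case: (boolP (e \in Z)) => [/ZE-> //|_].
by case: ifP => // /EEs/wt_ge0.
Qed.

(** Nothing links [F] to a solution here. Edges are charged with multiplicity, and passing from the
    list to the set can only lower its size and, weights being nonnegative, its weight. *)
Lemma accept_sound l b F L : {subset F <= Es} -> accept l b F L ->
  exists E : {set {set V}}, [/\ {subset E <= Es}, (#|E|%:Z <= l)%R,
    (\sum_(e in E) wt e <= b)%R & forall x, x \in L -> sat E x].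
Proof.
move=> subF; rewrite /accept; case choL: choose_centers => [s|//].
have [Z [subZ def_s satZ]] := choose_centers_sound choL.
rewrite spend_cat in def_s; rewrite {s choL}def_s /= => /andP[le_l le_b].
have sub : {subset F ++ Z <= Es} by move=> e; rewrite mem_cat => /orP[/subF|/subZ].
exists [set e in F ++ Z]; split.
- by move=> e; rewrite inE => /sub.
- have: #|[set e in F ++ Z]| <= size (F ++ Z) by rewrite cardsE card_size.
  by move: le_l; rewrite subr_ge0 -lez_nat => le1 le2; apply: le_trans le1.
- by apply: le_trans (sum_list_set sub) _; move: le_b; lra.
- move=> x /satZ/hasP[c cx st]; apply/hasP; exists c => //.
  by apply/starP => w wx nwc; rewrite inE; apply: (starP _ _ _ st).
Qed.

(** The greedy choice ties in number with a center of minimal number, so the lexicographic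
    comparison is decided by the weight. These comparisons add up over the items. *)
Lemma choose_centers_complete F L (cen : item V -> V) s :
  (forall x, x \in L -> [/\ cen x \in x.1, star [in Es] (cen x) x.2
    & forall c, c \in x.1 ->
        size (new_edges F (cen x) x.2) <= size (new_edges F c x.2)]) ->
  exists2 s', choose_centers F L (Some s) = Some s' &
    let s0 := spend s (flatten [seq new_edges F (cen x) x.2 | x <- L]) in
    s0.1 = s'.1 /\ (s0.2 <= s'.2)%R.
Proof.
elim: L s => [|x L IH] s cenP /=.
  by exists s; rewrite // /spend big_nil !subr0; split.
have [cx st min_x] := cenP _ (mem_head _ _).
have [s1 best_x] := best_max F s cx st; rewrite best_x /lex_le.
have [c [cA _ def_s1]] := best_center best_x; have le_sz := min_x _ cA.
have [|s' -> [eq1 le2]] := IH s1; first by move=> y yL; apply: cenP; rewrite inE yL orbT.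
move=> lex; exists s' => //; rewrite size_cat big_cat -eq1 /= {eq1}.
move: lex le2; rewrite def_s1 /=; set n := size _ in le_sz *; set m := size _ in le_sz *.
set wx := (\sum_(e <- new_edges F (cen x) _) _)%R; set wL := (\sum_(e <- flatten _) _)%R.
set wc := (\sum_(e <- new_edges F c _) _)%R.
(* A strictly smaller number of new edges would contradict the minimality of [cen x]. *)
case/orP => [|/andP[/eqP eq_n le_w] le2]; first lia.
by split; [lia|lra].
Qed.

(** [F] followed by the new edges of the stars of [E] is a duplicate-free list inside [E], hence
    within both budgets, and the greedy choice does at least as well. *)
Lemma accept_complete l b (E : {set {set V}}) (S : seq {set V}) L :
  simple_edges E -> {subset S <= E} -> short_cycles_in E S ->
  (forall x, x \in L -> wf_item x) -> (forall x, x \in L -> sat E x) ->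
  pairwise (unlinked (link_star S)) L ->
  uniq Es -> {in Es, forall e : {set V}, #|e| = 2} -> {subset E <= Es} ->
  (#|E|%:Z <= l)%R -> (\sum_(e in E) wt e <= b)%R ->
  accept l b (fixed_edges Es S L) L.
Proof.
move=> sE subS shE wfL satL unL uEs sEs subE le_l le_b.
set F := fixed_edges Es S L.
have subF : {subset F <= E} by apply: fixed_sub.
have uF : uniq F by rewrite filter_uniq.
have [Z [uZ subZ nZ [s' choL [eq1 le2]]]] : exists Z, [/\ uniq Z, {subset Z <= E},
    {in Z, forall e, e \notin F} & exists2 s',
    choose_centers F L (Some (spend (l, b) F)) = Some s' &
    let s0 := spend (l, b) (F ++ Z) in s0.1 = s'.1 /\ (s0.2 <= s'.2)%R].
  (* A nonempty list provides the vertex needed as the default value of [head]. *)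
  have [L0|[x0 x0L]] : L = [::] \/ exists x0, x0 \in L.
    by case: (L) => [|x0 L']; [left|right; exists x0; rewrite mem_head].
    exists [::]; split=> //; exists (spend (l, b) F); first by rewrite L0.
    by rewrite cats0; split.
  have /hasP[v0 _ _] := satL _ x0L.
  pose cen (x : item V) := head v0 [seq c <- x.1 | star E c x.2].
  have cenP x : x \in L -> (cen x \in x.1) && star E (cen x) x.2.
    move=> xL; rewrite andbC -(mem_filter (fun c => star E c x.2)) /cen.
    by have := satL _ xL; rewrite /sat has_filter; case: filter => //= c A _; rewrite mem_head.
  exists (flatten [seq new_edges F (cen x) x.2 | x <- L]); split.
  - by apply: (new_edges_disjoint sE subS shE wfL subE).
  - move=> e /flattenP[_ /mapP[x xL ->]]; have /andP[_ st] := cenP _ xL.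
    exact: new_edges_sub.
  - move=> e /flattenP[_ /mapP[x xL ->]]; have /andP[cx _] := cenP _ xL.
    by case/(new_edges_mem (wfL _ xL) cx).
  - rewrite -spend_cat; apply: choose_centers_complete => x xL.
    have /andP[cx st] := cenP _ xL; split=> //.
      apply/starP => w wx nwc; apply: subE; exact: (starP _ _ _ st).
    by move=> c; apply: (new_edges_min sE subS shE wfL satL unL sEs subE).
rewrite /accept choL.
have uFZ : uniq (F ++ Z) by rewrite cat_uniq uF uZ andbT /=; apply/hasPn.
have sFZ : {subset F ++ Z <= E} by move=> e; rewrite mem_cat => /orP[/subF|/subZ].
apply/andP; split.
  rewrite -eq1 /= subr_ge0; apply: le_trans le_l; rewrite lez_nat cardE.
  by apply: uniq_leq_size => // e /sFZ; rewrite mem_enum.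
have := sum_uniq_sub uFZ sFZ subE; move: le2 => /=; lra.
Qed.

End Greedy.

(** * Symbolic execution *)

Section WeakestPrecondition.
Variables (R : realType) (P : program).
Implicit Types (env : seq (value R)) (v w : value R) (e : expr).
Implicit Types (Q : value R -> nat -> Prop).

Definition fn (f : nat) w v (T : nat) :=
  exists2 t, t <= T & eval P [:: w] (nth ENil P f) v t.

(** Only an upper bound on the time of a called function is known, so the postcondition has to hold
    for every time up to [T]. *)
Definition wcall f w Q :=
  f < size P /\ exists v T, fn f w v T /\ forall t, t <= T -> Q v t.

(** Computes by simplification: a function is verified by evaluating its body symbolically, while
    calls stop at [wcall] and use specifications already proved. *)
Fixpoint wp env e Q : Prop :=
  match e with
  | EVar i => if drop i env is v :: _ then Q v 1 else False
  | ENil => Q VNil 1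
  | EInt z => Q (VInt z) 1
  | EPair a b =>
      wp env a (fun v t => wp env b (fun w t' => Q (VPair v w) (t + t').+1))
  | EFst a => wp env a (fun v t => if v is VPair x _ then Q x t.+1 else False)
  | ESnd a => wp env a (fun v t => if v is VPair _ y then Q y t.+1 else False)
  | ESucc a =>
      wp env a (fun v t => if v is VInt z then Q (VInt (z + 1)%R) t.+1 else False)
  | EPred a =>
      wp env a (fun v t => if v is VInt z then Q (VInt (z - 1)%R) t.+1 else False)
  | EAdd a b =>
      wp env a (fun v t => wp env b (fun w t' =>
        match v, w with
        | VReal x, VReal y => Q (VReal (x + y)%R) (t + t').+1
        | _, _ => False
        end))
  | ESub a b =>
      wp env a (fun v t => wp env b (fun w t' =>
        match v, w with
        | VReal x, VReal y => Q (VReal (x - y)%R) (t + t').+1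
        | _, _ => False
        end))
  | EIfPair c a b =>
      wp env c (fun w t =>
        if w is VPair _ _ then wp env a (fun v t' => Q v (t + t').+1)
        else wp env b (fun v t' => Q v (t + t').+1))
  | EIfLe c d a b =>
      wp env c (fun v t1 => wp env d (fun w t2 =>
        match v, w with
        | VInt x, VInt y =>
            if (x <= y)%R then wp env a (fun v t' => Q v (t1 + t2 + t').+1)
            else wp env b (fun v t' => Q v (t1 + t2 + t').+1)
        | VReal x, VReal y =>
            if (x <= y)%R then wp env a (fun v t' => Q v (t1 + t2 + t').+1)
            else wp env b (fun v t' => Q v (t1 + t2 + t').+1)
        | _, _ => False
        end))
  | ELet a b =>
      wp env a (fun v t => wp (v :: env) b (fun w t' => Q w (t + t').+1))
  | ECall f a => wp env a (fun v t => wcall f v (fun w t' => Q w (t + t').+1))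
  end.

Lemma wp_eval env e Q : wp env e Q -> exists v t, eval P env e v t /\ Q v t.
Proof.
elim: e env Q => /=.
- move=> i env Q; case def_v: drop => [//|v s] q.
  have lt_i : i < size env by rewrite ltnNge; apply/negP => /drop_oversize; rewrite def_v.
  have nth_i : nth VNil env i = v by rewrite -[i]addn0 -nth_drop def_v.
  by exists v, 1; split=> //; rewrite -nth_i; apply: eval_var.
- by move=> env Q q; do 2 eexists; split; [exact: eval_nil|].
- by move=> z env Q q; do 2 eexists; split; [exact: eval_int|].
- move=> a IHa b IHb env Q /IHa[v [t [ev1 /IHb[w [t' [ev2 q]]]]]].
  by do 2 eexists; split; [apply: eval_pair ev1 ev2|].
- move=> a IH env Q /IH[[|z|r|x y] [t [ev q]]] //.
  by do 2 eexists; split; [apply: eval_fst ev|].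
- move=> a IH env Q /IH[[|z|r|x y] [t [ev q]]] //.
  by do 2 eexists; split; [apply: eval_snd ev|].
- move=> a IH env Q /IH[[|z|r|x y] [t [ev q]]] //.
  by do 2 eexists; split; [apply: eval_succ ev|].
- move=> a IH env Q /IH[[|z|r|x y] [t [ev q]]] //.
  by do 2 eexists; split; [apply: eval_pred ev|].
- move=> a IHa b IHb env Q /IHa[v [t [ev1 /IHb[w [t' [ev2]]]]]].
  case: v ev1 => // x ev1; case: w ev2 => // y ev2 q.
  by do 2 eexists; split; [apply: eval_add ev1 ev2|].
- move=> a IHa b IHb env Q /IHa[v [t [ev1 /IHb[w [t' [ev2]]]]]].
  case: v ev1 => // x ev1; case: w ev2 => // y ev2 q.
  by do 2 eexists; split; [apply: eval_sub ev1 ev2|].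
- move=> c IHc a IHa b IHb env Q /IHc[w [t [ev1 q]]].
  have [v [t' [ev2 q']]] : exists v t',
      eval P env (if w is VPair _ _ then a else b) v t' /\ Q v (t + t').+1.
    by case: w {ev1} q => [|z|x|x y] q; [apply: IHb..|apply: IHa].
  by do 2 eexists; split; [apply: eval_ifpair ev1 ev2|].
- move=> c IHc d IHd a IHa b IHb env Q /IHc[v [t1 [ev1 /IHd[w [t2 [ev2 q]]]]]].
  have IH (l : bool) : (if l then wp env a (fun v t' => Q v (t1 + t2 + t').+1)
      else wp env b (fun v t' => Q v (t1 + t2 + t').+1)) ->
      exists v t', eval P env (if l then a else b) v t' /\ Q v (t1 + t2 + t').+1.
    by case: l => q'; [apply: IHa|apply: IHb].
  case: v ev1 q => // x ev1; case: w ev2 => // y ev2 /IH[v [t' [ev3 q]]].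
    by do 2 eexists; split; [apply: eval_ifle_int ev1 ev2 ev3|].
  by do 2 eexists; split; [apply: eval_ifle_real ev1 ev2 ev3|].
- move=> a IHa b IHb env Q /IHa[v [t [ev1 /IHb[w [t' [ev2 q]]]]]].
  by do 2 eexists; split; [apply: eval_let ev1 ev2|].
- move=> f a IH env Q /IH[w [t [ev1 [lt_f [v [T [[t' le_t' ev2] q]]]]]]].
  by do 2 eexists; split; [apply: eval_call lt_f ev1 ev2|exact: q].
Qed.

Lemma fn_intro e f w v T : nth ENil P f = e ->
  wp [:: w] e (fun v' t => v' = v /\ t <= T) -> fn f w v T.
Proof.
by move=> eq_e /wp_eval[v' [t [ev [<- le_t]]]]; exists t => //; rewrite eq_e.
Qed.

Lemma wcall_intro f w v T Q : fn f w v T -> f < size P ->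
  (forall t, t <= T -> Q v t) -> wcall f w Q.
Proof. by move=> ev lt_f q; split=> //; exists v, T. Qed.

Lemma fn_le f w v T T' : fn f w v T -> T <= T' -> fn f w v T'.
Proof. by move=> [t le_t ev] leT; exists t => //; apply: leq_trans leT. Qed.

End WeakestPrecondition.

(** * The program *)

(* Every function takes a list of arguments: [arg_at d i] is its [i]-th one below
   [d] binders. *)
Definition arg_at (d i : nat) : expr := EFst (iter i ESnd (EVar d)).
Notation arg := (arg_at 0).
Definition call (f : nat) (es : seq expr) : expr := ECall f (foldr EPair ENil es).
Notation etrue := (EPair ENil ENil).
Definition if_eq (x y a b : expr) : expr := EIfLe x y (EIfLe y x a b) b.

Definition fmem := 1.
Definition finter := 2.
Definition funion := 3.
Definition fapp := 4.
Definition ffind := 5.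
Definition fstar := 6.
Definition fcovered := 7.
Definition flink := 8.
Definition fins := 9.
Definition finsall := 10.
Definition fsub := 11.
Definition fhas1 := 12.
Definition fhas2 := 13.
Definition ffixed := 14.
Definition fpay := 15.
Definition fcost := 16.
Definition fbetter := 17.
Definition fbest := 18.
Definition fproc := 19.
Definition ftry := 20.
Definition fguess := 21.
Definition floop := 22.
Definition ftake := 23.
Definition fdrop := 24.
Definition fdropall := 25.
Definition fnonempty := 26.

Arguments arg_at / d i.
Arguments call / f es.
Arguments if_eq / x y a b.

Definition body_mem :=
  EIfPair (arg 1)
    (if_eq (arg 0) (EFst (arg 1)) etrue (call fmem [:: arg 0; ESnd (arg 1)]))
    ENil.

Definition body_inter :=
  EIfPair (arg 0)
    (EIfPair (call fmem [:: EFst (arg 0); arg 1])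
       (EPair (EFst (arg 0)) (call finter [:: ESnd (arg 0); arg 1]))
       (call finter [:: ESnd (arg 0); arg 1]))
    ENil.

Definition body_union :=
  EIfPair (arg 0)
    (EIfPair (call fmem [:: EFst (arg 0); arg 1])
       (call funion [:: ESnd (arg 0); arg 1])
       (EPair (EFst (arg 0)) (call funion [:: ESnd (arg 0); arg 1])))
    (arg 1).

Definition body_app :=
  EIfPair (arg 0)
    (EPair (EFst (arg 0)) (call fapp [:: ESnd (arg 0); arg 1])) (arg 1).

(** The entry itself is returned: being a pair it counts as true, and its weight can be read off. *)
Definition body_find :=
  let a := EFst (EFst (EFst (arg 0))) in
  let b := EFst (ESnd (EFst (EFst (arg 0)))) in
  let next := call ffind [:: ESnd (arg 0); arg 1; arg 2] in
  EIfPair (arg 0)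
    (if_eq a (arg 1) (if_eq b (arg 2) (EFst (arg 0)) next)
       (if_eq a (arg 2) (if_eq b (arg 1) (EFst (arg 0)) next) next))
    ENil.

Definition body_star :=
  let next := call fstar [:: arg 0; arg 1; ESnd (arg 2)] in
  EIfPair (arg 2)
    (if_eq (EFst (arg 2)) (arg 1) next
       (EIfPair (call ffind [:: arg 0; arg 1; EFst (arg 2)]) next ENil))
    etrue.

Definition body_covered :=
  EIfPair (arg 0)
    (EIfPair (call fstar [:: arg 1; EFst (arg 0); arg 2]) etrue
       (call fcovered [:: ESnd (arg 0); arg 1; arg 2]))
    ENil.

(* The context, [arg 0], is [ENil] when the components of the hypergraph are
   computed, and else the pair of the vertex list and the guessed edges. *)
Definition body_link :=
  EIfPair (arg 0)
    (EIfPair (arg 1)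
       (EIfPair (ESnd (arg 1))
          (EIfPair (ESnd (ESnd (arg 1)))
             (EIfPair (call fcovered [:: EFst (arg 0); ESnd (arg 0); arg 1])
                ENil etrue)
             ENil)
          ENil)
       ENil)
    (EIfPair (arg 1) etrue ENil).

(** [arg 2] holds the items still to be compared with the inserted one, [arg 3] those found unlinked
    with it. A merge enlarges the inserted item, so all others have to be compared again. *)
Definition body_ins :=
  let y := EFst (arg 2) in
  EIfPair (arg 2)
    (EIfPair (call flink [:: arg 0; call finter [:: ESnd (arg 1); ESnd y]])
       (call fins [:: arg 0;
          EPair (call finter [:: EFst (arg 1); EFst y])
                (call funion [:: ESnd (arg 1); ESnd y]);
          call fapp [:: ESnd (arg 2); arg 3]; ENil])
       (call fins [:: arg 0; arg 1; ESnd (arg 2); EPair y (arg 3)]))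
    (EPair (arg 1) (arg 3)).

Definition body_insall :=
  EIfPair (arg 1)
    (call fins [:: arg 0; EPair (EFst (arg 1)) (EFst (arg 1));
                   call finsall [:: arg 0; ESnd (arg 1)]; ENil])
    ENil.

Definition body_sub :=
  EIfPair (arg 0)
    (EIfPair (call fmem [:: EFst (arg 0); arg 1])
       (call fsub [:: ESnd (arg 0); arg 1]) ENil)
    etrue.

Definition body_has1 :=
  EIfPair (arg 0)
    (EIfPair (call fsub [:: arg 1; ESnd (EFst (arg 0))]) etrue
       (call fhas1 [:: ESnd (arg 0); arg 1]))
    ENil.

Definition body_has2 :=
  EIfPair (arg 0)
    (EIfPair (call fsub [:: arg 1; ESnd (EFst (arg 0))])
       (call fhas1 [:: ESnd (arg 0); arg 1])
       (call fhas2 [:: ESnd (arg 0); arg 1]))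
    ENil.

Definition body_fixed :=
  let e := EFst (EFst (arg 3)) in
  let next := call ffixed [:: arg 0; arg 1; arg 2; ESnd (arg 3)] in
  EIfPair (arg 3)
    (EIfPair
       (EIfPair (call fcovered [:: arg 0; arg 1; e])
          (call ffind [:: arg 1; EFst e; EFst (ESnd e)])
          (call fhas2 [:: arg 2; e]))
       (EPair (EFst (arg 3)) next) next)
    ENil.

Definition body_pay :=
  EIfPair (arg 0)
    (call fpay [:: ESnd (arg 0); EPred (arg 1); ESub (arg 2) (ESnd (EFst (arg 0)))])
    (EPair (arg 1) (arg 2)).

Definition body_cost :=
  let find_in l := call ffind [:: l; arg 0; EFst (arg 1)] in
  let next st := call fcost [:: arg 0; ESnd (arg 1); arg 2; arg 3; st] in
  EIfPair (arg 1)
    (if_eq (EFst (arg 1)) (arg 0) (next (arg 4))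
       (EIfPair (find_in (arg 2))
          (EIfPair (find_in (arg 3)) (next (arg 4))
             (next (EPair (EPred (EFst (arg 4)))
                          (ESub (ESnd (arg 4)) (ESnd (find_in (arg 2)))))))
          ENil))
    (arg 4).

Definition body_better :=
  EIfPair (arg 0)
    (EIfPair (arg 1)
       (EIfLe (EFst (arg 0)) (EFst (arg 1))
          (EIfLe (EFst (arg 1)) (EFst (arg 0))
             (EIfLe (ESnd (arg 0)) (ESnd (arg 1)) (arg 1) (arg 0))
             (arg 1))
          (arg 0))
       (arg 0))
    (arg 1).

Definition body_best :=
  EIfPair (arg 0)
    (call fbetter [::
       call fcost [:: EFst (arg 0); arg 1; arg 2; arg 3; arg 4];
       call fbest [:: ESnd (arg 0); arg 1; arg 2; arg 3; arg 4]])
    ENil.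

Definition body_proc :=
  let x := EFst (arg 0) in
  EIfPair (arg 3)
    (EIfPair (arg 0)
       (call fproc [:: ESnd (arg 0); arg 1; arg 2;
          call fbest [:: EFst x; ESnd x; arg 1; arg 2; arg 3]])
       (arg 3))
    ENil.

Definition component (i : nat) (e : expr) : expr := EFst (iter i ESnd e).

Arguments component / i e.

(* In the absence of real literals, [0 <= r] is tested as [b - r <= b]. *)
Definition body_try :=
  let inst d i := component i (arg_at d 0) in
  ELet (call finsall [:: EPair (inst 0 0) (arg 1); inst 0 2])
    (ELet (call ffixed [:: inst 1 0; arg_at 1 1; EVar 0; inst 1 1])
       (ELet (call fproc [:: EVar 1; inst 2 1; EVar 0;
                             call fpay [:: EVar 0; inst 2 3; inst 2 4]])
          (EIfPair (EVar 0)
             (EIfLe (EInt 0) (EFst (EVar 0))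
                (EIfLe (ESub (inst 3 4) (ESnd (EVar 0))) (inst 3 4) etrue ENil)
                ENil)
             ENil))).

Definition body_guess :=
  EIfPair (call ftry [:: arg 0; arg 2]) etrue
    (EIfPair (arg 1)
       (call floop [:: arg 0; ESnd (arg 1); arg 2; component 1 (arg 0)])
       ENil).

Definition body_loop :=
  EIfPair (arg 3)
    (EIfPair (call fguess [:: arg 0; arg 1; EPair (EFst (arg 3)) (arg 2)]) etrue
       (call floop [:: arg 0; arg 1; arg 2; ESnd (arg 3)]))
    ENil.

(* Numbers of guesses are unary: four cells for each unit of [t]. Cutting the edge
   budget down to the number of edges keeps the counter of polynomial length. *)
Definition body_take :=
  EIfLe (EInt 1) (arg 0)
    (EIfPair (arg 1)
       (iter 4 (EPair ENil) (call ftake [:: EPred (arg 0); ESnd (arg 1)]))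
       ENil)
    ENil.

Definition body_drop :=
  EIfPair (arg 1)
    (EIfPair (arg 0) (call fdrop [:: iter 4 ESnd (arg 0); ESnd (arg 1)]) ENil)
    (arg 0).

Definition body_dropall :=
  EIfPair (arg 1)
    (call fdropall [:: call fdrop [:: arg 0; ESnd (ESnd (EFst (arg 1)))];
                       ESnd (arg 1)])
    (arg 0).

Definition body_nonempty :=
  EIfPair (arg 0)
    (EIfPair (EFst (arg 0)) (call fnonempty [:: ESnd (arg 0)]) ENil) etrue.

(** An empty community has no center, so the answer is no; past this test, every vertex list whose
    tail [fdropall] uses is nonempty. *)
Definition body_main :=
  EIfPair (call fnonempty [:: arg 2])
    (EIfPair
       (call fguess [:: EVar 0;
          call fdropall [:: call ftake [:: arg 3; arg 1];
                            call finsall [:: ENil; arg 2]];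
          ENil])
       (EInt 1) (EInt 0))
    (EInt 0).

Definition stars_program : program :=
  [:: body_main; body_mem; body_inter; body_union; body_app; body_find; body_star;
      body_covered; body_link; body_ins; body_insall; body_sub; body_has1;
      body_has2; body_fixed; body_pay; body_cost; body_better; body_best;
      body_proc; body_try; body_guess; body_loop; body_take; body_drop;
      body_dropall; body_nonempty].

(** * Correctness and running time of the functions *)

Ltac call_with H := apply: (wcall_intro H) => //= ? ?.
Ltac finish := try (split=> //; lia).

Section Specs.
Variables (R : realType) (I : instance R).
Notation V := 'I_(nvert I).
Notation P := stars_program.
Implicit Types (i j c u v : V) (X U A : seq V) (e : {set V}) (S F : seq {set V}).
Implicit Types (x y : item V) (L : seq (item V)).

Definition vvert i : value R := VInt (val i)%:Z.
Definition vset X : value R := vlist (map vvert X).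
Definition vedge e : value R := VPair (vset (enum e)) (VReal (weight I e)).
Definition vedges S : value R := vlist (map vedge S).
Definition vitem x : value R := VPair (vset x.1) (vset x.2).
Definition vitems L : value R := vlist (map vitem L).
Definition vbool (b : bool) : value R := if b then VPair VNil VNil else VNil.
Definition vstate (o : option (int * R)) : value R :=
  if o is Some s then VPair (VInt s.1) (VReal s.2) else VNil.

(* [Tf N] bounds the time of the function [f] on lists of length at most [N]. *)
Definition Tmem N := N.+1 * 60.

Lemma mem_fn k i X : size X <= k ->
  fn P fmem (vlist [:: vvert i; vset X]) (vbool (i \in X)) (Tmem k).
Proof.
rewrite /Tmem; elim: X k => [|j X IH] k le_k; apply: (fn_intro (e := body_mem)) => //=.
case: k le_k => // k le_k; rewrite mulSn !lez_nat inE -val_eqE.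
by case: (ltngtP i j) => [lt|gt|eq_ij] /=; finish; call_with (IH k le_k); finish.
Qed.


Lemma inter_fn N k X U : size U <= N -> size X <= k ->
  fn P finter (vlist [:: vset X; vset U]) (vset (inter X U)) (k.+1 * (Tmem N + 60)).
Proof.
move=> leN; elim: X k => [|j X IH] k le_k; apply: (fn_intro (e := body_inter)) => //=.
case: k le_k => // k le_k; rewrite mulSn; call_with (mem_fn j leN).
by rewrite /vbool; case: (j \in U) => /=; call_with (IH k le_k); finish.
Qed.

Lemma union_fn N k X U : size U <= N -> size X <= k ->
  fn P funion (vlist [:: vset X; vset U]) (vset (union X U)) (k.+1 * (Tmem N + 60)).
Proof.
move=> leN; elim: X k => [|j X IH] k le_k; apply: (fn_intro (e := body_union)) => //=.
case: k le_k => // k le_k; rewrite mulSn; call_with (mem_fn j leN).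
by rewrite /vbool /union /=; case: (j \in U) => /=; call_with (IH k le_k); finish.
Qed.

Lemma app_fn k (s t : seq (value R)) : size s <= k ->
  fn P fapp (vlist [:: vlist s; vlist t]) (vlist (s ++ t)) (k.+1 * 30).
Proof.
elim: s k => [|v s IH] k le_k; apply: (fn_intro (e := body_app)) => //=.
case: k le_k => // k le_k; rewrite mulSn; call_with (IH k le_k); finish.
Qed.

Lemma enum_edge e : #|e| = 2 -> exists a b, [/\ a != b, enum e = [:: a; b] & e = [set a; b]].
Proof.
rewrite cardE => sz_e; have := enum_uniq e; have mem_e := mem_enum e.
case def_e: (enum e) sz_e mem_e => [|a [|b [|? ?]]] //= _ mem_e.
rewrite inE andbT => nab; exists a, b; split=> //.
by apply/setP => v; rewrite -mem_e !inE.
Qed.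

Definition simple_list S := forall e, e \in S -> #|e| = 2.

Lemma simple_behead e S : simple_list (e :: S) -> #|e| = 2 /\ simple_list S.
Proof.
move=> sS; split; first by apply: sS; rewrite mem_head.
by move=> e' eS; apply: sS; rewrite inE eS orbT.
Qed.

Definition Tfind N := N.+1 * 100.

Lemma find_fn k S u v : simple_list S -> size S <= k ->
  fn P ffind (vlist [:: vedges S; vvert u; vvert v])
    (if [set u; v] \in S then vedge [set u; v] else VNil) (Tfind k).
Proof.
rewrite /Tfind.
elim: S k => [|e S IH] k sS le_k; apply: (fn_intro (e := body_find)) => //=.
have [/enum_edge[a [b [nab enum_e def_e]]] {}/IH IH] := simple_behead sS.
case: k le_k => // k le_k; rewrite mulSn enum_e /= !lez_nat.
have found : [set u; v] == e -> vedge e =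
    if [set u; v] \in e :: S then vedge [set u; v] else VNil.
  by move=> /eqP->; rewrite mem_head.
have skip : [set u; v] != e -> ([set u; v] \in e :: S) = ([set u; v] \in S).
  by rewrite inE => /negPf->.
have eq_e : ([set u; v] == e) = (a == u) && (b == v) || (a == v) && (b == u).
  by rewrite def_e set2_eq -![u == _]val_eqE -![v == _]val_eqE !(eq_sym (val u))
             !(eq_sym (val v)) !val_eqE [(a == v) && _]andbC.
move: eq_e nab found skip; rewrite -!val_eqE.
by case: (ltngtP a u) => [lt1|gt1|eq1] /=; case: (ltngtP b v) => [lt2|gt2|eq2] /=;
   case: (ltngtP a v) => [lt3|gt3|eq3] /=; case: (ltngtP b u) => [lt4|gt4|eq4] /=;
   move=> -> nab found skip; finish;
   (try by split; [exact: found|lia]); (try by exfalso; move/eqP: nab; lia);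
   call_with (IH k le_k); rewrite -skip //; finish.
Qed.

Definition Tstar N := N.+1 * (Tfind N + 100).

Lemma star_fn N k S c X : simple_list S -> size S <= N -> size X <= k -> k <= N ->
  fn P fstar (vlist [:: vedges S; vvert c; vset X]) (vbool (star [in S] c X)) (Tstar N).
Proof.
move=> sS leN le_k le_kN; apply: (@fn_le _ _ _ _ _ (k.+1 * (Tfind N + 100))); last first.
  by rewrite leq_mul2r ltnS le_kN orbT.
elim: X k le_k {le_kN} => [|w X IH] k le_k; apply: (fn_intro (e := body_star)) => //=.
case: k le_k => // k le_k; rewrite mulSn !lez_nat -val_eqE.
case: (ltngtP w c) => [lt|gt|eq_w] /=.
- call_with (find_fn c w sS leN); change ([set c; w] \in [in S]) with ([set c; w] \in S).
  by case: ifP => _ /=; finish; call_with (IH k le_k); finish.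
- call_with (find_fn c w sS leN); change ([set c; w] \in [in S]) with ([set c; w] \in S).
  by case: ifP => _ /=; finish; call_with (IH k le_k); finish.
- by call_with (IH k le_k); finish.
Qed.

End Specs.

Section BoundedSpecs.
Variables (R : realType) (I : instance R).
Notation V := 'I_(nvert I).
Notation P := stars_program.
Implicit Types (i j c u v : V) (X U A : seq V) (e : {set V}) (S F : seq {set V}).
Implicit Types (x y : item V) (L : seq (item V)).
Local Notation vset := (@vset R I).
Local Notation vvert := (@vvert R I).
Local Notation vitem := (@vitem R I).
Local Notation vitems := (@vitems R I).
Local Notation vbool := (vbool R).
Variable N : nat.

Definition Tsub := N.+1 * (Tmem N + 60).

Lemma sub_fn X U : size U <= N -> size X <= N ->
  fn P fsub (vlist [:: vset X; vset U]) (vbool (all [in U] X)) Tsub.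
Proof.
move=> leU leX; suff: forall k, size X <= k ->
  fn P fsub (vlist [:: vset X; vset U]) (vbool (all [in U] X)) (k.+1 * (Tmem N + 60)).
  exact.
elim: X {leX} => [|j X IH] k le_k; apply: (fn_intro (e := body_sub)) => //=.
case: k le_k => // k le_k; rewrite mulSn; call_with (mem_fn j leU).
by rewrite /vbool; case: (j \in U) => /=; finish; call_with (IH k le_k); finish.
Qed.

Hypothesis leVN : #|V| <= N.

Definition Tcovered := N.+1 * (Tstar N + 60).

Lemma covered_fn S X : simple_list S -> size S <= N -> size X <= N ->
  fn P fcovered (vlist [:: vset (enum [set: V]); vedges S; vset X])
    (vbool (covered S X)) Tcovered.
Proof.
move=> sS leS leX.
suff: forall A k, size A <= k -> fn P fcovered (vlist [:: vset A; vedges S; vset X])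
    (vbool (has (fun c => star [in S] c X) A)) (k.+1 * (Tstar N + 60)).
  move=> /(_ (enum [set: V]) N); rewrite -cardE cardsT => /(_ leVN).
  congr fn; congr vbool; apply/hasP/existsP => [[c _ st]|[c st]]; exists c => //.
  by rewrite mem_enum inE.
elim=> [|c A IH] k le_k; apply: (fn_intro (e := body_covered)) => //=.
case: k le_k => // k le_k; rewrite mulSn; call_with (star_fn c sS leS leX (leqnn N)).
by rewrite /vbool; case: star => /=; finish; call_with (IH k le_k); finish.
Qed.

Definition vctx (o : option (seq {set V})) : value R :=
  if o is Some S0 then VPair (vset (enum [set: V])) (vedges S0) else VNil.
Definition link o X := if o is Some S0 then link_star S0 X else link_hyper X.
Definition ctx_ok (o : option (seq {set V})) :=
  forall S, o = Some S -> simple_list S /\ size S <= N.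
Definition Tlink := Tcovered + 100.

Lemma link_fn o X : ctx_ok o -> size X <= N ->
  fn P flink (vlist [:: vctx o; vset X]) (vbool (link o X)) Tlink.
Proof.
move=> ok_o leX; apply: (fn_intro (e := body_link)) => //=; rewrite /Tlink.
case: o ok_o => [S|_] /=; last by case: X {leX} => [|c X] /=; finish.
case/(_ S erefl)=> sS leS; case: X leX => [|a [|b [|c X]]] leX /=; finish.
call_with (covered_fn sS leS leX); rewrite /link_star /=.
by case: covered => /=; finish.
Qed.

(** [x.2] is duplicate free and so no longer than the number of vertices; [x.1] may contain
    repetitions and needs its own bound. *)
Definition item_ok x := wf_item x && (size x.1 <= N).

Lemma item_ok_size x : item_ok x -> size x.2 <= N.
Proof.
by case/andP=> /andP[/card_uniqP<- _] _; apply: leq_trans leVN; apply: max_card.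
Qed.

Lemma item_ok_merge x y : item_ok x -> item_ok y -> item_ok (merge_items x y).
Proof.
move=> /andP[wx lx] /andP[wy ly]; rewrite /item_ok wf_merge //=.
by rewrite (leq_trans (size_inter _ _)).
Qed.

(** [pairwise] depends on the order of the list, and an item passing from [L] to [K] moves behind
    the rest of [L]. *)
Lemma unlinkedC o x y : item_ok x -> item_ok y ->
  unlinked (link o) x y = unlinked (link o) y x.
Proof.
move=> /andP[/andP[ux _] _] /andP[/andP[uy _] _]; congr (~~ _).
have p := perm_interC ux uy.
by case: o => [S|]; [apply: link_star_perm|apply: link_hyper_perm].
Qed.

Definition Tmerge := N.+1 * (Tmem N + 60).
Definition Tstep := Tlink + Tmerge + Tmerge + Tmerge + N.+1 * 30 + 200.
Definition Tins := (N + N * N.+1).+1 * Tstep.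

Lemma ins_fn o x L K : ctx_ok o -> item_ok x -> (forall y, y \in L ++ K -> item_ok y) ->
  size L + size K <= N -> all (unlinked (link o) x) K ->
  pairwise (unlinked (link o)) (L ++ K) ->
  exists L', [/\ merges (link o) (x :: L ++ K) L', pairwise (unlinked (link o)) L'
    & fn P fins (vlist [:: vctx o; vitem x; vitems L; vitems K]) (vitems L') Tins].
Proof.
move=> ok_o ok_x ok_L le_N unl_x unl_L.
suff [L' [m unl f]] : exists L', [/\ merges (link o) (x :: L ++ K) L',
    pairwise (unlinked (link o)) L'
    & fn P fins (vlist [:: vctx o; vitem x; vitems L; vitems K]) (vitems L')
       ((N + N * N.+1).+1 * Tstep)] by exists L'.
(* Termination measure. Passing an item from [L] to [K] lowers the first summand; a merge lowers the
   total number of items, and the factor [N.+1] outweighs the return of [K] to the unchecked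
   items. *)
have: size L + (size L + size K) * N.+1 <= N + N * N.+1.
  by rewrite leq_add ?leq_mul2r ?le_N ?orbT // (leq_trans (leq_addr _ _) le_N).
elim: (N + N * N.+1) x L K ok_x ok_L le_N unl_x unl_L => [|m IH] x L K.
all: move=> ok_x ok_L le_N unl_x unl_L le_m.
all: case: L ok_L le_N unl_L le_m => [|y L] /= ok_L le_N unl_L le_m.
- exists (x :: K); split; [exact: merges_perm|by rewrite /= unl_x|].
  by apply: (fn_intro (e := body_ins)) => //=; rewrite /Tstep; finish.
- by rewrite addSn in le_m.
- exists (x :: K); split; [exact: merges_perm|by rewrite /= unl_x|].
  by apply: (fn_intro (e := body_ins)) => //=; rewrite /Tstep; finish.
have ok_y : item_ok y by apply: ok_L; rewrite mem_head.
have {}ok_L z : z \in L ++ K -> item_ok z by move=> zL; apply: ok_L; rewrite inE zL orbT.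
have [lx ly] := (item_ok_size ok_x, item_ok_size ok_y).
have [/andP[_ lx1] /andP[_ ly1]] := (ok_x, ok_y).
have lI : size (inter x.2 y.2) <= N := leq_trans (size_inter _ _) lx.
have /andP[unl_y unl_LK] := unl_L.
have le_L : size L <= N by lia.
case: (boolP (link o (inter x.2 y.2))) => lxy.
  have [||||||L' [mL' unl' f]] := IH (merge_items x y) (L ++ K) [::].
  - exact: item_ok_merge.
  - by rewrite cats0.
  - by rewrite addn0 size_cat; lia.
  - by [].
  - by rewrite cats0.
  - by rewrite addn0 size_cat; move: le_m; rewrite !mulnDl mulSn; lia.
  rewrite cats0 in mL'; exists L'; split=> //; first exact: merges_step mL'.
  apply: (fn_intro (e := body_ins)) => //=; rewrite mulSn.
  call_with (inter_fn ly lx); call_with (link_fn ok_o lI); rewrite lxy /=.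
  call_with (inter_fn ly1 lx1); call_with (union_fn ly lx).
  have le_L' : size (map vitem L) <= N by rewrite size_map.
  call_with (app_fn (map vitem K) le_L'); rewrite -map_cat.
  by call_with f; split=> //; rewrite {1}/Tstep /Tmerge; lia.
have [|||||L' [mL' unl' f]] := IH x L (y :: K) ok_x.
- move=> z; rewrite mem_cat inE orbCA => /predU1P[-> //|].
  by rewrite -mem_cat; apply: ok_L.
- by rewrite /= addnS.
- by rewrite /= {1}/unlinked lxy.
- have sub s : {subset s <= L ++ K} -> all (unlinked (link o) y) s ->
      all (unlinked (link o) ^~ y) s.
    move=> sub_s /allP unl; apply/allP => z zs; rewrite /= unlinkedC ?unl //.
    by apply: ok_L; apply: sub_s.
  move: unl_y unl_LK; rewrite !pairwise_cat all_cat allrel_consr /=.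
  move=> /andP[yL yK] /and3P[-> -> ->]; rewrite yK !andbT /=.
  by apply: sub yL => z zL; rewrite mem_cat zL.
- by move: le_m => /=; rewrite -addSnnS; lia.
exists L'; split=> //.
  apply: merges_perml mL'; rewrite perm_cons perm_sym -(cat1s y K).
  by rewrite perm_catCA perm_refl.
apply: (fn_intro (e := body_ins)) => //=; rewrite mulSn.
call_with (inter_fn ly lx); call_with (link_fn ok_o lI); rewrite (negPf lxy) /=.
by call_with f; split=> //; rewrite {1}/Tstep /Tmerge; lia.
Qed.

Definition community_item (C : {set V}) : item V := (enum C, enum C).
Definition Tinsall := N.+1 * (Tins + 100).

Lemma community_item_ok C : item_ok (community_item C).
Proof.
rewrite /item_ok /wf_item /= enum_uniq -cardE (leq_trans (max_card _) leVN) andbT /=.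
by apply/allP.
Qed.

Lemma insall_fn o (Cs : seq {set V}) : ctx_ok o -> size Cs <= N ->
  exists L', [/\ merges (link o) (map community_item Cs) L',
    pairwise (unlinked (link o)) L'
    & fn P finsall (vlist [:: vctx o; vlist (map (@encode_vset R _) Cs)])
       (vitems L') Tinsall].
Proof.
move=> ok_o le_Cs; suff: forall k, size Cs <= k -> k <= N ->
  exists L', [/\ merges (link o) (map community_item Cs) L',
    pairwise (unlinked (link o)) L'
    & fn P finsall (vlist [:: vctx o; vlist (map (@encode_vset R _) Cs)])
       (vitems L') (k.+1 * (Tins + 100))] by apply.
elim: Cs {le_Cs} => [|C Cs IH] k le_k le_kN.
  exists [::]; split=> //; first exact: merges_perm.
  by apply: (fn_intro (e := body_insall)) => //=; finish.
case: k le_k le_kN => // k le_k le_kN.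
have [L1 [m1 unl1 f1]] := IH k le_k (ltnW le_kN).
have ok1 : forall y, y \in L1 -> item_ok y.
  apply: (merges_forward _ m1) => [x y _|y /mapP[D _ ->]]; first exact: item_ok_merge.
  exact: community_item_ok.
have [||||L' [m' unl' f']] := ins_fn (L := L1) (K := [::]) ok_o (community_item_ok C).
- by rewrite cats0.
- by rewrite addn0 (leq_trans (merges_size m1)) // size_map (leq_trans (n := k)) // ltnW.
- by [].
- by rewrite cats0.
rewrite cats0 in m'; exists L'; split=> //.
  exact: merges_trans (merges_cons _ m1) m'.
apply: (fn_intro (e := body_insall)) => //=; rewrite mulSn.
by call_with f1; call_with f'; finish.
Qed.

Definition Thas := N.+1 * (Tsub + 60).

Lemma has1_fn k L X : (forall x, x \in L -> item_ok x) -> size X <= N -> size L <= k ->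
  fn P fhas1 (vlist [:: vitems L; vset X])
    (vbool (has (fun x => all [in x.2] X) L)) (k.+1 * (Tsub + 60)).
Proof.
move=> + leX; elim: L k => [|x L IH] k ok_L le_k; apply: (fn_intro (e := body_has1)) => //=.
case: k le_k => // k le_k; rewrite mulSn.
have leU : size x.2 <= N by apply/item_ok_size/ok_L/mem_head.
have {}ok_L y : y \in L -> item_ok y by move=> yL; apply: ok_L; rewrite inE yL orbT.
call_with (sub_fn leU leX).
by rewrite /vbool; case: all => /=; finish; call_with (IH k ok_L le_k); finish.
Qed.

Lemma has2_fn L X : (forall x, x \in L -> item_ok x) -> size X <= N -> size L <= N ->
  fn P fhas2 (vlist [:: vitems L; vset X])
    (vbool (1 < count (fun x => all [in x.2] X) L)) Thas.
Proof.
move=> + leX + ; suff: forall k, (forall x, x \in L -> item_ok x) -> size L <= k ->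
  fn P fhas2 (vlist [:: vitems L; vset X])
    (vbool (1 < count (fun x => all [in x.2] X) L)) (k.+1 * (Tsub + 60)) by apply.
elim: L => [|x L IH] k ok_L le_k; apply: (fn_intro (e := body_has2)) => //=.
case: k le_k => // k le_k; rewrite mulSn.
have leU : size x.2 <= N by apply/item_ok_size/ok_L/mem_head.
have {}ok_L y : y \in L -> item_ok y by move=> yL; apply: ok_L; rewrite inE yL orbT.
call_with (sub_fn leU leX); rewrite {1}/vbool; case: all => /=.
  by call_with (has1_fn ok_L leX le_k); rewrite add1n ltnS -has_count; finish.
by call_with (IH k ok_L le_k); finish.
Qed.

Definition Tfixed := N.+1 * (Tcovered + Tfind N + Thas + 200).

Lemma fixed_fn Es S L : simple_list Es -> simple_list S -> size Es <= N -> size S <= N ->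
  (forall x, x \in L -> item_ok x) -> size L <= N -> 2 <= N ->
  fn P ffixed (vlist [:: vset (enum [set: V]); vedges S; vitems L; vedges Es])
    (vedges (fixed_edges Es S L)) Tfixed.
Proof.
move=> sEs sS leEs leS ok_L leL le2N; suff: forall k, size Es <= k ->
  fn P ffixed (vlist [:: vset (enum [set: V]); vedges S; vitems L; vedges Es])
    (vedges (fixed_edges Es S L)) (k.+1 * (Tcovered + Tfind N + Thas + 200)) by apply.
elim: Es {leEs} sEs => [|e Es IH] sEs k le_k; apply: (fn_intro (e := body_fixed)) => //=.
have [sz_e {}/IH IH] := simple_behead sEs.
have [a [b [_ enum_e def_e]]] := enum_edge sz_e.
have le_e : size (enum e) <= N by rewrite -cardE sz_e.
case: k le_k => // k le_k; rewrite mulSn; call_with (covered_fn sS leS le_e).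
case: covered => /=.
  have := find_fn a b sS leS; rewrite -def_e enum_e /= => find_e; call_with find_e.
  by case: ifP => _ /=; call_with (IH k le_k); finish.
call_with (has2_fn ok_L le_e leL); rewrite {1}/vbool; case: ifP => _ /=.
  by call_with (IH k le_k); finish.
by call_with (IH k le_k); finish.
Qed.

End BoundedSpecs.

Section Greedy.
Variables (R : realType) (I : instance R).
Notation V := 'I_(nvert I).
Notation P := stars_program.
Implicit Types (i j c u v : V) (X U A : seq V) (e : {set V}) (S F : seq {set V}).
Implicit Types (x y : item V) (L : seq (item V)).
Local Notation vset := (@vset R I).
Local Notation vvert := (@vvert R I).
Local Notation vitem := (@vitem R I).
Local Notation vitems := (@vitems R I).
Local Notation vbool := (vbool R).
Notation wt := (weight I).
Implicit Types (s : int * R) (o : option (int * R)).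

Lemma spend_cons s e F :
  spend wt s (e :: F) = spend wt (s.1 - 1, s.2 - wt e)%R F.
Proof. by rewrite /spend big_cons /=; congr pair; [lia|rewrite opprD addrA]. Qed.

(** [n] is the minimum of [l] and the number of edges, truncated at 0. *)
Lemma take_fn (l : int) S k : size S <= k ->
  exists n, [/\ (forall a, (a%:Z <= l)%R -> a <= size S -> a <= n),
    n = 0 \/ (n%:Z <= l)%R, n <= size S
    & fn P ftake (vlist [:: VInt l; vedges S]) (vlist (nseq (4 * n) VNil)) (k.+1 * 60)].
Proof.
elim: S l k => [|e S IH] l k le_k.
  exists 0; split=> //; first by left.
  by apply: (fn_intro (e := body_take)) => //=; case: ifP => _ /=; finish.
case: k le_k => // k le_k; have [n [lo hi le_n f]] := IH (l - 1)%R k le_k.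
case: (leP 1%R l) => le_l.
  exists n.+1; split=> //.
  - by case=> // a le_a; rewrite /= !ltnS; apply: lo; lia.
  - by right; move: hi; lia.
  rewrite (mulnS 4); apply: (fn_intro (e := body_take)) => //=; rewrite (mulSn k.+1) le_l.
  by call_with f; finish.
exists 0; split=> //; [by move=> a; lia|by left|].
by apply: (fn_intro (e := body_take)) => //=; rewrite leNgt le_l /=; finish.
Qed.

Lemma drop_fn n X k : size X <= k ->
  fn P fdrop (vlist [:: vlist (nseq (4 * n) VNil); vset X])
    (vlist (nseq (4 * (n - size X)) VNil)) (k.+1 * 60).
Proof.
elim: X n k => [|w X IH] n k le_k; apply: (fn_intro (e := body_drop)) => //=.
  by rewrite subn0; finish.
case: k le_k => // k le_k; rewrite (mulSn k.+1).
case: n => [|n]; first by rewrite muln0 /=; finish.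
rewrite mulnS /= subSS; call_with (IH n k le_k); finish.
Qed.

Lemma nonempty_fn (Cs : seq {set V}) k : size Cs <= k ->
  fn P fnonempty (vlist [:: vlist (map (@encode_vset R _) Cs)])
    (vbool (set0 \notin Cs)) (k.+1 * 60).
Proof.
elim: Cs k => [|C Cs IH] k le_k; apply: (fn_intro (e := body_nonempty)) => //=.
case: k le_k => // k le_k; rewrite (mulSn k.+1) inE negb_or /encode_vset.
have -> : (set0 != C) = (enum C != [::]) by rewrite eq_sym -size_eq0 -cardE cards_eq0.
by case: (enum C) => [|w X] /=; finish; call_with (IH k le_k); finish.
Qed.

Lemma better_fn o o' :
  fn P fbetter (vlist [:: vstate o; vstate o']) (vstate (better o o')) 100.
Proof.
apply: (fn_intro (e := body_better)) => //.
case: o o' => [s|] [s'|] /=; finish.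
by case: (s.1 <= s'.1)%R; case: (s'.1 <= s.1)%R; case: (s.2 <= s'.2)%R => /=; finish.
Qed.

Variable N : nat.

Definition Tpay := N.+1 * 60.

Lemma pay_fn F s : size F <= N ->
  fn P fpay (vlist [:: vedges F; VInt s.1; VReal s.2]) (vstate (Some (spend wt s F))) Tpay.
Proof.
move=> leF; suff: forall k, size F <= k -> fn P fpay
  (vlist [:: vedges F; VInt s.1; VReal s.2]) (vstate (Some (spend wt s F))) (k.+1 * 60).
  exact.
elim: F s {leF} => [|e F IH] s k le_k; rewrite ?spend_cons;
  apply: (fn_intro (e := body_pay)) => //=.
  by rewrite /spend big_nil !subr0; finish.
case: k le_k => // k le_k; rewrite mulSn.
by call_with (IH (s.1 - 1, s.2 - wt e)%R k le_k); finish.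
Qed.

Definition Tcost := N.+1 * (Tfind N + Tfind N + Tfind N + 200).

Lemma cost_fn Es F c X s : simple_list Es -> simple_list F ->
  size Es <= N -> size F <= N -> size X <= N ->
  fn P fcost (vlist [:: vvert c; vset X; vedges Es; vedges F; vstate (Some s)])
    (vstate (cost Es wt F c X s)) Tcost.
Proof.
move=> sEs sF leEs leF leX; suff: forall k, size X <= k ->
  fn P fcost (vlist [:: vvert c; vset X; vedges Es; vedges F; vstate (Some s)])
    (vstate (cost Es wt F c X s)) (k.+1 * (Tfind N + Tfind N + Tfind N + 200)).
  exact.
elim: X s {leX} => [|w X IH] s k le_k; apply: (fn_intro (e := body_cost)) => //=.
  by rewrite /cost /= /spend big_nil !subr0; finish.
case: k le_k => // k le_k; rewrite mulSn !lez_nat.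
have eq_w : (w == c) = (w == c :> nat) by [].
have costE : cost Es wt F c (w :: X) s =
    if w == c then cost Es wt F c X s
    else if [set c; w] \in Es then
      if [set c; w] \in F then cost Es wt F c X s
      else cost Es wt F c X (s.1 - 1, s.2 - wt [set c; w])%R
    else None.
  rewrite /cost /= /new_edges /=; case: (w == c) => //=.
  change ([set c; w] \in [in Es]) with ([set c; w] \in Es).
  case: (_ \in Es) => //=; case: (_ \in F) => //=.
  by case: ifP => // _; rewrite -spend_cons.
move: costE; rewrite eq_w.
have f1 := find_fn c w sEs leEs; have f2 := find_fn c w sF leF.
case: (ltngtP w c) => [lt|gt|eq_wc] /= ->; last by call_with (IH s k le_k); finish.
- call_with f1; case: ifP => inEs /=; finish.
  call_with f2; case: ifP => inF /=; first by call_with (IH s k le_k); finish.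
  call_with f1; rewrite inEs /=.
  by call_with (IH (s.1 - 1, s.2 - wt [set c; w])%R k le_k); finish.
- call_with f1; case: ifP => inEs /=; finish.
  call_with f2; case: ifP => inF /=; first by call_with (IH s k le_k); finish.
  call_with f1; rewrite inEs /=.
  by call_with (IH (s.1 - 1, s.2 - wt [set c; w])%R k le_k); finish.
Qed.

Definition Tbest := N.+1 * (Tcost + 300).

Lemma best_fn Es F A X s : simple_list Es -> simple_list F ->
  size Es <= N -> size F <= N -> size A <= N -> size X <= N ->
  fn P fbest (vlist [:: vset A; vset X; vedges Es; vedges F; vstate (Some s)])
    (vstate (best Es wt F A X s)) Tbest.
Proof.
move=> sEs sF leEs leF leA leX; suff: forall k, size A <= k ->
  fn P fbest (vlist [:: vset A; vset X; vedges Es; vedges F; vstate (Some s)])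
    (vstate (best Es wt F A X s)) (k.+1 * (Tcost + 300)).
  exact.
elim: A {leA} => [|c A IH] k le_k; apply: (fn_intro (e := body_best)) => //=.
case: k le_k => // k le_k; rewrite mulSn.
call_with (cost_fn c s sEs sF leEs leF leX); call_with (IH k le_k).
by call_with (better_fn (cost Es wt F c X s) (best Es wt F A X s)); finish.
Qed.

Hypothesis leVN : #|V| <= N.

Definition Tproc := N.+1 * (Tbest + 100).

Lemma proc_fn Es F L o : simple_list Es -> simple_list F ->
  size Es <= N -> size F <= N -> size L <= N ->
  (forall x, x \in L -> item_ok N x) ->
  fn P fproc (vlist [:: vitems L; vedges Es; vedges F; vstate o])
    (vstate (choose_centers Es wt F L o)) Tproc.
Proof.
move=> sEs sF leEs leF leL; suff: forall k, size L <= k ->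
  (forall x, x \in L -> item_ok N x) ->
  fn P fproc (vlist [:: vitems L; vedges Es; vedges F; vstate o])
    (vstate (choose_centers Es wt F L o)) (k.+1 * (Tbest + 100)).
  by apply.
elim: L o {leL} => [|x L IH] [s|] k le_k ok_L; apply: (fn_intro (e := body_proc)) => //=.
  case: k le_k => // k le_k; rewrite mulSn.
  have ok_x : item_ok N x by apply: ok_L; rewrite mem_head.
  have {}ok_L y : y \in L -> item_ok N y by move=> yL; apply: ok_L; rewrite inE yL orbT.
  have leA : size x.1 <= N by case/andP: ok_x.
  call_with (best_fn s sEs sF leEs leF leA (item_ok_size leVN ok_x)).
  by call_with (IH (best Es wt F x.1 x.2 s) k le_k ok_L); finish.
Qed.

Definition Ttry := Tinsall N + Tfixed N + Tproc + Tpay + 500.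
Notation Es := (enum (edges I)).

Lemma try_fn S : simple_list S -> size S <= N -> size Es <= N -> 2 <= N ->
  #|communities I| <= N ->
  exists L, [/\ merges (link_star S) (map (@community_item R I) (enum (communities I))) L,
    pairwise (unlinked (link_star S)) L,
    forall x, x \in L -> item_ok N x
    & fn P ftry (vlist [:: encode I; vedges S])
        (vbool (accept Es wt (edge_budget I) (weight_budget I) (fixed_edges Es S L) L))
        Ttry].
Proof.
move=> sS leS leEs le2N leC.
have sEs : simple_list Es by move=> e; rewrite mem_enum; apply: edges_simple.
have ok_ctx : ctx_ok N (Some S) by move=> _ [<-].
have leCs : size (enum (communities I)) <= N by rewrite -cardE.
have [L [mL unlL f_ins]] := insall_fn leVN ok_ctx leCs.
have ok_L x : x \in L -> item_ok N x.
  move: x; apply: (merges_forward _ mL) => [x y _|_ /mapP[C _ ->]].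
    exact: item_ok_merge.
  exact: community_item_ok.
have leL : size L <= N by rewrite (leq_trans (merges_size mL)) // size_map.
exists L; split=> //; apply: (fn_intro (e := body_try)) => //=.
set F := fixed_edges Es S L.
have sF : simple_list F by move=> e; rewrite mem_filter => /andP[_ /sEs].
have leF : size F <= N by rewrite size_filter (leq_trans (count_size _ _)).
call_with f_ins; call_with (fixed_fn leVN sEs sS leEs leS ok_L leL le2N).
call_with (pay_fn (edge_budget I, weight_budget I) leF).
call_with (proc_fn (Some (spend wt (edge_budget I, weight_budget I) F)) sEs sF leEs leF leL ok_L).
rewrite /accept /Ttry; case: (choose_centers Es wt F L _) => [s|] /=; finish.
by case: (0 <= s.1)%R; case: (weight_budget I - s.2 <= weight_budget I)%R => /=; finish.
Qed.

Definition Tdropall := N.+1 * (Tpay + 100).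

Lemma dropall_fn n L k : size L <= k ->
  (forall x, x \in L -> item_ok N x /\ x.2 != [::]) ->
  fn P fdropall (vlist [:: vlist (nseq (4 * n) VNil); vitems L])
    (vlist (nseq (4 * (n - size (flatten (map (fun x => behead x.2) L)))) VNil))
    (k.+1 * (Tpay + 100)).
Proof.
rewrite /Tpay.
elim: L n k => [|x L IH] n k le_k ok_L; apply: (fn_intro (e := body_dropall)) => //=.
  by rewrite subn0; finish.
case: k le_k => // k le_k; rewrite (mulSn k.+1) size_cat subnDA.
have [ok_x nx] := ok_L x (mem_head _ _).
have {}ok_L y : y \in L -> item_ok N y /\ y.2 != [::].
  by move=> yL; apply: ok_L; rewrite inE yL orbT.
have := item_ok_size leVN ok_x; case: x.2 nx => [//|w X] _ /= leX.
have f := drop_fn n (ltnW leX); call_with f.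
by call_with (IH (n - size X) k le_k ok_L); finish.
Qed.

End Greedy.

(** * Guessing the edges on short cycles *)

Section Guess.
Variables (R : realType) (I : instance R).
Notation V := 'I_(nvert I).
Notation P := stars_program.
Implicit Types (e C : {set V}) (S : seq {set V}) (E : {set {set V}}).
Local Notation vbool := (vbool R).
Notation Es := (enum (edges I)).

Definition solution E :=
  [/\ E \subset edges I, (#|E|%:Z <= edge_budget I)%R,
      (\sum_(e in E) weight I e <= weight_budget I)%R
    & forall C, C \in communities I -> has_spanning_star E C].

Lemma sat_community E C : sat E (community_item C) <-> has_spanning_star E C.
Proof.
split=> [/hasP[c cC /starP st]|[c cC st]].
  by exists c => [|v vC]; [rewrite mem_enum in cC|apply: st; rewrite mem_enum].
apply/hasP; exists c; first by rewrite mem_enum.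
by apply/starP => w; rewrite mem_enum; apply: st.
Qed.

Variable N : nat.
Hypotheses (leV : #|V| <= N) (leE : #|edges I| <= N) (leC : #|communities I| <= N).
Hypothesis le2 : 2 <= N.

(** A positive answer is right for any set of edges; the last clause asks the guess to be inside a
    solution and to contain its short cycles. *)
Lemma try_correct S : {subset S <= edges I} -> size S <= N -> exists b,
  [/\ fn P ftry (vlist [:: encode I; vedges S]) (vbool b) (Ttry N), b -> yes_instance I
    & forall E, solution E -> {subset S <= E} -> short_cycles_in E S -> b].
Proof.
move=> subS leS.
have sS : simple_list S by move=> e /subS; apply: edges_simple.
have leEs : size Es <= N by rewrite -cardE.
have [L [mL unlL ok_L f]] := try_fn leV sS leS leEs le2 leC.
have wt0 : {in Es, forall e, (0 <= weight I e)%R}.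
  by move=> e; rewrite mem_enum; apply: weight_ge0.
eexists; split; first exact: f.
  case/(accept_sound wt0) => [e|E [subE le_l le_b satE]].
    by rewrite mem_filter => /andP[].
  exists E; split=> //; first by apply/subsetP => e /subE; rewrite mem_enum.
  move=> C CI; apply/sat_community.
  apply: (merges_backward (Q := sat E) _ mL satE); first by move=> x y; apply: sat_merge.
  by apply/mapP; exists C; rewrite ?mem_enum.
move=> E [/subsetP subE le_l le_b stars] SE shE.
have sE : simple_edges E by move=> e /subE; apply: edges_simple.
apply: (accept_complete wt0 sE SE shE) => //.
- by move=> x /ok_L/andP[].
- have h x : x \in L -> sat E x /\ wf_item x.
    move: x; apply: (merges_forward _ mL) => [x y lxy [sx wx] [sy wy]|_ /mapP[C CI ->]].
      by split; [apply: link_star_sat lxy sx sy|apply: wf_merge].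
    split; last by case/andP: (community_item_ok leV C).
    by apply/sat_community/stars; rewrite -mem_enum.
  by move=> x /h[].
- exact: enum_uniq.
- by move=> e; rewrite mem_enum; apply: edges_simple.
- by move=> e /subE; rewrite mem_enum.
Qed.

(* [try] is run at every node of the search tree, so that fewer than [n] edges can
   be guessed as well. *)
Definition guess_base := Ttry N + N * 100 + 300.
Definition Tguess n := n.+1 * maxn 1 #|edges I| ^ n * guess_base.

(** The search puts each new edge in front of the earlier ones; with [catrev] the guesses still to
    come and those already made fit together by computation. *)
Lemma guess_correct n S : {subset S <= edges I} -> size S + n <= N -> exists b,
  [/\ fn P fguess (vlist [:: encode I; vlist (nseq n VNil); vedges S]) (vbool b) (Tguess n),
      b -> yes_instance I
    & forall E S', solution E -> size S' <= n -> {subset catrev S' S <= E} ->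
        short_cycles_in E (catrev S' S) -> b].
Proof.
elim: n S => [|n IH] S subS leS.
  have [|b [f snd cpl]] := try_correct subS; first by rewrite -(addn0 (size S)).
  exists b; split=> //; last by move=> E [|//] solE _; apply: cpl.
  apply: (fn_intro (e := body_guess)) => //=; call_with f.
  by rewrite /Tguess /guess_base /vbool; case: b {f snd cpl} => /=; finish.
have [|b [f snd cpl]] := try_correct subS; first by lia.
have loop (Ls : seq {set V}) : {subset Ls <= edges I} -> exists b,
  [/\ fn P floop (vlist [:: encode I; vlist (nseq n VNil); vedges S; vedges Ls]) (vbool b)
        (size Ls * (Tguess n + 100) + 100),
      b -> yes_instance I
    & forall e E S', e \in Ls -> solution E -> size S' <= n ->
        {subset catrev S' (e :: S) <= E} -> short_cycles_in E (catrev S' (e :: S)) -> b].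
  elim: Ls => [|e Ls IHl] subL.
    by exists false; split=> //; apply: (fn_intro (e := body_loop)).
  have [|b1 [f1 snd1 cpl1]] := IHl; first by move=> x xL; apply: subL; rewrite inE xL orbT.
  have [||b2 [f2 snd2 cpl2]] := IH (e :: S).
  - by move=> x; rewrite inE => /predU1P[->|/subS//]; apply: subL; rewrite mem_head.
  - by rewrite /= addSnnS.
  exists (b2 || b1); split.
  - apply: (fn_intro (e := body_loop)) => //=; call_with f2; rewrite mulSn.
    by rewrite {1}/vbool; case: b2 {f2 snd2 cpl2} => /=; finish; call_with f1; finish.
  - by case/orP.
  - move=> x E S'; rewrite inE => /predU1P[->|xL] solE leS' sub sh; apply/orP.
      by left; apply: cpl2 sub sh.
    by right; apply: cpl1 xL solE leS' sub sh.
have [e|b1 [f1 snd1 cpl1]] := loop Es; first by rewrite mem_enum.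
exists (b || b1); split.
- apply: (fn_intro (e := body_guess)) => //=; call_with f.
  (* [Tguess n.+1] counts n+2 levels of at most [M ^ n.+1] nodes. Of these, n+1 absorb the recursive
     calls and one pays for the node itself and its loop over the edges. *)
  have: Ttry N + size Es * (Tguess n + 100) + 300 <= Tguess n.+1.
    rewrite -cardE; set m := #|edges I|; set M := maxn 1 m; set B := guess_base.
    have -> : Tguess n.+1 = M ^ n.+1 * B + n.+1 * M ^ n.+1 * B.
      by rewrite /Tguess [n.+2 * _]mulSn mulnDl.
    have h1 : m * Tguess n <= n.+1 * M ^ n.+1 * B.
      rewrite /Tguess mulnA leq_mul2r mulnCA leq_mul2l; apply/orP; right.
      by rewrite expnS leq_mul2r leq_maxr !orbT.
    have h2 : B <= M ^ n.+1 * B by rewrite leq_pmull // expn_gt0 leq_maxl.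
    have h3 : m * 100 <= N * 100 by rewrite leq_mul2r leE orbT.
    have defB : B = Ttry N + N * 100 + 300 by [].
    rewrite mulnDr; lia.
  rewrite {1}/vbool; case: b {f snd cpl} => /= le_T; finish.
  by call_with f1; finish.
- by case/orP.
- move=> E [|e S'] solE leS' sub sh; apply/orP; first by left; apply: cpl solE sub sh.
  right; apply: (cpl1 e E S') => //; case: solE => /subsetP subE _ _ _.
  rewrite mem_enum; apply/subE/sub.
  by rewrite catrevE mem_cat mem_rev mem_head.
Qed.

End Guess.

(** * The main program *)

Section Main.
Variables (R : realType) (I : instance R).
Notation V := 'I_(nvert I).
Notation P := stars_program.
Implicit Types (e C : {set V}) (S : seq {set V}) (E : {set {set V}}).
Implicit Types (x y : item V) (L : seq (item V)).
Local Notation vbool := (vbool R).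
Notation Es := (enum (edges I)).
Notation Cs := (enum (communities I)).

Definition hyper_rank L := size (flatten (map behead (map snd L))).

Section Groups.
Variable L : seq (item V).
Hypothesis mL : merges (@link_hyper V) (map (@community_item R I) Cs) L.
Hypothesis unlL : pairwise (unlinked (@link_hyper V)) L.

Lemma groups_wf x : x \in L -> wf_item x.
Proof.
move: x; apply: (merges_forward _ mL) => [x y _|_ /mapP[C _ ->]]; first exact: wf_merge.
by rewrite /wf_item /= enum_uniq; apply/allP.
Qed.

Lemma groups_uniq : uniq (flatten (map snd L)).
Proof.
elim: (L) unlL groups_wf => //= x L' IH /andP[unl unlL'] wfL.
rewrite cat_uniq IH // ?andbT; last by move=> y yL; apply: wfL; rewrite inE yL orbT.
have /andP[-> _] := wfL x (mem_head _ _); apply/hasPn => v /flattenP[_ /mapP[y yL ->] vy].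
apply/negP => vx; move/allP/(_ y yL): unl; rewrite /unlinked negbK => /eqP inter0.
by have := mem_inter x.2 y.2 v; rewrite inter0 vx vy.
Qed.

Lemma groups_cover C : C \in communities I ->
  exists2 X, X \in map snd L & {subset C <= X}.
Proof.
move=> CI; have [||y yL sub] := merges_cover (p := [in C]) (x := community_item C) mL.
- by apply/mapP; exists C; rewrite ?mem_enum.
- by move=> v vC; rewrite mem_enum.
by exists y.2 => //; apply/mapP; exists y.
Qed.

Lemma rank_hcomponents :
  nvert I <= hyper_rank L + #|hcomponents (communities I)|.
Proof. by have := hcomponents_behead groups_uniq groups_cover; rewrite card_ord. Qed.

(** Each community is connected by its star, hence also after the deletion of [Q], and merged lists
    share a vertex. So [E :\: Q] connects every list of [L] and has at least [hyper_rank L] edges,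
    which bounds [Q]. *)
Lemma short_cycles_rank E : solution E -> exists S,
  [/\ {subset S <= E}, short_cycles_in E S & size S <= 4 * (#|E| - hyper_rank L)].
Proof.
case=> /subsetP subE _ _ stars.
have sE : simple_edges E by move=> e /subE; apply: edges_simple.
have [S [Q [SE shE QE leS conE]]] := short_cycle_cover sE.
exists S; split=> //; apply: leq_trans leS _; rewrite leq_mul2l /=.
have sT : simple_edges (E :\: Q) by move=> e /setDP[/sE].
have := behead_rank sT groups_uniq; rewrite cardsD (setIidPr QE) => le_rank.
have sub_swap a b c : b <= a -> c <= a - b -> b <= a - c by lia.
apply: sub_swap (subset_leq_card QE) _; apply: le_rank => _ /mapP[x xL ->]; move: x xL.
have conC := sym_connect_sym (@adjC _ (E :\: Q)).
apply: (merges_forward _ mL) => [x y lxy conx cony u v|_ /mapP[C CI ->] u v].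
  have [w] : exists w, w \in inter x.2 y.2.
    by move: lxy; rewrite /link_hyper; case: inter => // w s _; exists w; rewrite mem_head.
  rewrite mem_inter !mem_union => /andP[wx wy].
  have con_w z : (z \in x.2) || (z \in y.2) -> connect (adj (E :\: Q)) z w.
    by case/orP=> zX; [apply: conx|apply: cony].
  by move=> /con_w cu /con_w cv; apply: connect_trans cu _; rewrite conC.
rewrite mem_enum in CI; have [c cC st] := stars _ CI.
have con_c z : z \in enum C -> connect (adj (E :\: Q)) c z.
  rewrite mem_enum => zC; have [->|nzc] := eqVneq z c; first exact: connect0.
  by apply: conE; apply: st.
by move=> /con_c cu /con_c cv; apply: connect_trans cv; rewrite conC.
Qed.

End Groups.

Lemma vsize_vlist (s : seq (value R)) : size s <= vsize (vlist s).
Proof. by elim: s => //= v s IH; rewrite ltnS (leq_trans IH) // leq_addl. Qed.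

Lemma vsize_mem (s : seq (value R)) v : List.In v s -> vsize v <= vsize (vlist s).
Proof. by elim: s => //= w s IH [->|/IH]; lia. Qed.

Lemma size_bounds : [/\ #|V| <= instance_size I, #|edges I| <= instance_size I
  & #|communities I| <= instance_size I].
Proof.
split.
- apply: leq_trans (vsize_mem (v := encode_vset R [set: V]) _); last by left.
  by apply: leq_trans (vsize_vlist _); rewrite size_map -cardE cardsT.
- apply: leq_trans (vsize_mem (v := vedges Es) _); last by right; left.
  by apply: leq_trans (vsize_vlist _); rewrite size_map -cardE.
- apply: leq_trans (vsize_mem (v := vlist (map (@encode_vset R _) Cs)) _).
    by apply: leq_trans (vsize_vlist _); rewrite size_map -cardE.
  by do 2!right; left.
Qed.

End Main.

Definition Tmain N := N.+1 * 60 + (N.+1 * 60 + (Tinsall N +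
  (Tdropall N + (N.+1 * guess_base N + 200)))).

Section Main.
Variables (R : realType) (I : instance R).
Notation V := 'I_(nvert I).
Notation P := stars_program.
Local Notation vbool := (vbool R).

Lemma main_correct : exists (answer : bool) (time : nat),
  [/\ answer <-> yes_instance I,
      runs P (encode I) (VInt (nat_of_bool answer)%:Z) time
    & time <= maxn 1 #|edges I| ^ (4 * `|Num.max 0%R (fb_edge_number I)|%N)
              * Tmain (4 * instance_size I + 2)].
Proof.
(* The factor 4 makes room for the guessed edges, four for each unit of the cut budget; the summand
   2 for the two ends of an edge. *)
set N := 4 * instance_size I + 2; set expo := 4 * _.
set M := maxn 1 #|edges I|.
(* The two extra steps are the call of the entry point and the evaluation of its argument. *)
suff [b [T [yesP f leT]]] : exists (b : bool) T,
    [/\ b <-> yes_instance I, fn P 0 (encode I) (VInt (nat_of_bool b)%:Z) T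
      & T + 2 <= M ^ expo * Tmain N].
  case: f => t le_t ev; exists b, (1 + t).+1; split=> //; last first.
    by apply: leq_trans leT; lia.
  by apply: eval_call ev => //; apply: eval_var.
have Mexp : 0 < M ^ expo by rewrite expn_gt0 leq_maxl.
have [leV' leE' leC'] := size_bounds I.
have leV : #|V| <= N by apply: leq_trans leV' _; rewrite /N; lia.
have leE : #|edges I| <= N by apply: leq_trans leE' _; rewrite /N; lia.
have leC : #|communities I| <= N by apply: leq_trans leC' _; rewrite /N; lia.
have leEs : size (enum (edges I)) <= N by rewrite -cardE.
have leCs : size (enum (communities I)) <= N by rewrite -cardE.
have le2 : 2 <= N by rewrite leq_addl.
have f1 := nonempty_fn (R := R) leCs.
have [ne|] := boolP (set0 \notin enum (communities I)); last first.
  rewrite negbK mem_enum => in0; exists false, (Tmain N - 2); split.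
  - by split=> // -[E [_ _ _ /(_ _ in0)[c]]]; rewrite inE.
  - apply: (fn_intro (e := body_main)) => //=; call_with f1.
    by rewrite mem_enum in0 /=; split=> //; rewrite /Tmain; lia.
  - by rewrite subnK ?leq_pmull // /Tmain; lia.
have ok_ctx : ctx_ok (I := I) N None by [].
have [L [mL unlL f3]] := insall_fn leV ok_ctx leCs.
rewrite /link in mL unlL.
have [n [lo hi le_n f2]] := take_fn (edge_budget I) leEs.
have leL : size L <= N by rewrite (leq_trans (merges_size mL)) // size_map.
have okL x : x \in L -> item_ok N x /\ x.2 != [::].
  move: x; apply: (merges_forward _ mL) => [x y _ [okx nx] [oky ny]|_ /mapP[C CI ->]].
    split; first exact: item_ok_merge.
    by rewrite -size_eq0 size_cat addn_eq0 negb_and !size_eq0 ny orbT.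
  split; first exact: community_item_ok.
  by apply: contraNneq ne => /= C0; rewrite -(_ : C = set0) //; apply/eqP; rewrite -cards_eq0 cardE C0.
have f4 := dropall_fn leV n leL okL.
set rk := size _ in f4.
have def_rk : rk = hyper_rank L by rewrite /rk /hyper_rank -map_comp.
have le_4n : size ([::] : seq {set V}) + 4 * (n - rk) <= N.
  have : n <= instance_size I by rewrite (leq_trans le_n) // -cardE.
  by rewrite add0n /N; have := leq_subr rk n; lia.
have [//|b [f5 snd cpl]] := guess_correct leV leE leC le2 _ le_4n.
exists b, (N.+1 * 60 + (N.+1 * 60 + (Tinsall N + (Tdropall N +
  (Tguess I N (4 * (n - rk)) + 198))))); split.
- split=> // -[E solE]; have [S [SE shE leS]] := short_cycles_rank mL unlL solE.
  apply: (cpl E (rev S) solE).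
  + rewrite size_rev (leq_trans leS) // leq_mul2l /= def_rk leq_sub2r //.
    case: solE => subE le_l _ _; apply: lo => //.
    by rewrite -cardE subset_leq_card.
  + by move=> e; rewrite catrevE cats0 revK; apply: SE.
  + by rewrite catrevE cats0 revK.
- apply: (fn_intro (e := body_main)) => //=; call_with f1; rewrite ne /=.
  call_with f2; call_with f3; call_with f4; call_with f5.
  by rewrite /Tdropall; case: (b) => /=; finish.
have le_e : 4 * (n - rk) <= expo.
  rewrite leq_mul2l /=; have := rank_hcomponents mL unlL; rewrite -def_rk => le_rk.
  (* If the cut budget is 0, nothing is guessed; otherwise it is at most the edge budget, and the
     rank is at least n - x. *)
  case: hi => [->//|hi]; rewrite /fb_edge_number; lia.
have le_g : Tguess I N (4 * (n - rk)) <= M ^ expo * (N.+1 * guess_base N).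
  rewrite /Tguess mulnAC mulnC leq_mul ?leq_pexp2l ?leq_maxl //.
  by rewrite leq_mul2r ltnS -(add0n (4 * _)) le_4n orbT.
have h (a : nat) : a <= M ^ expo * a by rewrite leq_pmull.
move: le_g; rewrite /Tmain; move: (N.+1 * guess_base N) => B le_g.
by rewrite -!addnA !mulnDr !leq_add ?h.
Qed.

End Main.

(** * Polynomiality of the time bound *)

Definition is_poly (f : nat -> nat) := exists p : {poly nat}, forall n, p.[n]%R = f n.

Lemma is_poly_const c : is_poly (fun=> c).
Proof. by exists (c%:P)%R => n; rewrite hornerC. Qed.

Lemma is_poly_id : is_poly (fun n => n).
Proof. by exists 'X%R => n; rewrite hornerX. Qed.

Lemma is_polyD f g : is_poly f -> is_poly g -> is_poly (fun n => f n + g n).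
Proof. by move=> [p hp] [q hq]; exists (p + q)%R => n; rewrite hornerD hp hq. Qed.

Lemma is_polyM f g : is_poly f -> is_poly g -> is_poly (fun n => f n * g n).
Proof. by move=> [p hp] [q hq]; exists (p * q)%R => n; rewrite hornerM hp hq. Qed.

Lemma is_polyS f : is_poly f -> is_poly (fun n => (f n).+1).
Proof. by move=> pf; have := is_polyD (is_poly_const 1) pf. Qed.

Lemma is_poly_comp f g : is_poly f -> is_poly g -> is_poly (fun n => f (g n)).
Proof. by move=> [p hp] [q hq]; exists (p \Po q)%R => n; rewrite horner_comp hq hp. Qed.

Lemma is_poly_Tmain : is_poly Tmain.
Proof.
rewrite /Tmain /guess_base /Tdropall /Ttry /Tproc /Tbest /Tcost /Tpay /Tfixed /Thas /Tsub.
rewrite /Tinsall /Tins /Tstep /Tmerge /Tlink /Tcovered /Tstar /Tfind /Tmem.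
by repeat first [exact: is_poly_const | exact: is_poly_id | apply: is_polyD
  | apply: is_polyM | apply: is_polyS].
Qed.

Theorem theorem9 (R : realType) :
  exists (P : program) (p : {poly nat}),
    forall I : instance R,
      exists (answer : bool) (time : nat),
        [/\ answer <-> yes_instance I,
            runs P (encode I) (VInt (nat_of_bool answer)%:Z) time
          & time <= maxn 1 #|edges I| ^ (4 * `|Num.max 0%R (fb_edge_number I)|%N)
                    * p.[instance_size I]%R].
Proof.
have [p def_p] : is_poly (fun n => Tmain (4 * n + 2)).
  apply: is_poly_comp is_poly_Tmain _; apply: is_polyD (is_poly_const 2).
  exact: is_polyM (is_poly_const 4) is_poly_id.
by exists stars_program, p => I; rewrite def_p; apply: main_correct.
Qed.
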